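(* Let $A$ be either $K\{X\}_\infty$ or $K\{X\}$ and let $W$ be its space of primitive elements of positive degree. Then $(A,\Delta_a)$ is the cofree conilpotent cocommutative coalgebra cogenerated by $W$; i.e. $(A,\Delta_a)$ is isomorphic, as a graded counital coalgebra, to the coalgebra $\bigoplus_{n\ge0}(W^{\otimes n})^{\Sigma_n}$ of symmetric tensors in the tensor coalgebra on $W$ with the deconcatenation coproduct.
   Context: $K$ is a field of characteristic $0$ and $X=\{x_1,x_2,\dots\}$ a finite or countable set of variables. A planar rooted tree is reduced if no vertex has exactly one incoming edge. $K\{X\}_\infty$ is the $K$-vector space with basis the ''monomials'': the empty tree $1$ and all finite planar reduced rooted trees with leaves labelled by elements of $X$. For $k\ge2$, $\vee^k$ sends nonempty monomials $T^1,\dots,T^k$ to the tree obtained by grafting them (in order) onto a new root, extended multilinearly, with unit conventions: arguments equal to $1$ are omitted ($\vee^1=\mathrm{id}$, $\vee^k(1,\dots,1)=1$). This is the free unitary $\mathcal Mag_\omega$-algebra on $X$, graded by number of leaves. $K\{X\}\subset K\{X\}_\infty$ is the span of $1$ and the binary trees, the free unitary magma algebra with $a\cdot b=\vee^2(a,b)$. $A\otimes A$ carries the operations componentwise ($\vee^k(a_1\otimes b_1,\dots,a_k\otimes b_k)=\vee^k(a_1,\dots,a_k)\otimes\vee^k(b_1,\dots,b_k)$, with the unit conventions). The co-addition $\Delta_a:A\to A\otimes A$ is the unique unital homomorphism for these operations with $\Delta_a(x_i)=x_i\otimes1+1\otimes x_i$; counit is the projection onto degree $0$. $f$ is primitive if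 $\Delta_a(f)=f\otimes1+1\otimes f$. *)

(* Defs.v *)
From HB Require Import structures.
From mathcomp Require Import all_boot all_order all_algebra.
From mathcomp Require Import finmap.
From mathcomp.multinomials Require Import monalg.

Set Implicit Arguments.
Unset Strict Implicit.
Unset Printing Implicit Defensive.

Import Order.TTheory GRing.Theory.
Local Open Scope ring_scope.

Section Trees.
Variable X : countType.

(* planar rooted trees with leaves labelled in X; [MNode [::]] is the
   empty tree 1 *)
Inductive mtree : Type := MLeaf of X | MNode of seq mtree.

Fixpoint mtree_enc (t : mtree) : GenTree.tree X :=
  match t with
  | MLeaf x => GenTree.Leaf x
  | MNode ts => GenTree.Node 0 (map mtree_enc ts)
  end.

Fixpoint mtree_dec (g : GenTree.tree X) : mtree :=
  match g with
  | GenTree.Leaf x => MLeaf x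
  | GenTree.Node _ gs => MNode (map mtree_dec gs)
  end.

Fixpoint mtree_encK (t : mtree) : mtree_dec (mtree_enc t) = t :=
  match t return mtree_dec (mtree_enc t) = t with
  | MLeaf x => erefl
  | MNode ts => f_equal MNode
      ((fix aux (l : seq mtree) : map mtree_dec (map mtree_enc l) = l :=
          match l return map mtree_dec (map mtree_enc l) = l with
          | [::] => erefl
          | t :: l' => f_equal2 cons (mtree_encK t) (aux l')
          end) ts)
  end.

End Trees.

HB.instance Definition _ (X : countType) :=
  Countable.copy (mtree X) (can_type (@mtree_encK X)).

Section Algebra.
Variables (K : fieldType) (X : countType).

Local Notation mtree := (mtree X).

Definition one : mtree := MNode [::].

(* reduced trees: no vertex with exactly one incoming edge, and no
   empty subtree; [ismon] = monomials of K{X}_oo, [isbin] = monomials of K{X} *)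
Fixpoint isred (t : mtree) : bool :=
  match t with
  | MLeaf _ => true
  | MNode ts => (2 <= size ts)%N && all isred ts
  end.
Fixpoint isbintree (t : mtree) : bool :=
  match t with
  | MLeaf _ => true
  | MNode ts => (size ts == 2)%N && all isbintree ts
  end.
Definition ismon (t : mtree) : bool := (t == one) || isred t.
Definition isbin (t : mtree) : bool := (t == one) || isbintree t.

Fixpoint deg (t : mtree) : nat :=
  match t with
  | MLeaf _ => 1%N
  | MNode ts => sumn (map deg ts)
  end.

Definition lift (S T : choiceType) (F : S -> {malg K[T]}) (f : {malg K[S]})
  : {malg K[T]} := \sum_(s <- msupp f) f@_s *: F s.

Definition tens (S T : choiceType) (u : {malg K[S]}) (v : {malg K[T]})
  : {malg K[(S * T)%type]} :=
  \sum_(a <- msupp u) \sum_(b <- msupp v) << u@_a * v@_b *g (a, b) >>.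

(* u_1 (x) ... (x) u_n, as an element of the free module on sequences *)
Definition expand (S : choiceType) (us : seq {malg K[S]}) : {malg K[seq S]} :=
  foldr (fun u acc => lift (fun a => lift (fun s => << a :: s >>) acc) u)
        << [::] >> us.

Definition veeM (s : seq mtree) : mtree :=
  match filter (fun t => t != one) s with
  | [::] => one
  | [:: t] => t
  | r => MNode r
  end.

Definition veeA (fs : seq {malg K[mtree]}) : {malg K[mtree]} :=
  lift (fun s => << veeM s >>) (expand fs).

Definition vee_tens (zs : seq {malg K[(mtree * mtree)%type]})
  : {malg K[(mtree * mtree)%type]} :=
  lift (fun s => << (veeM (unzip1 s), veeM (unzip2 s)) >>) (expand zs).

(* the co-addition on monomials: the unital homomorphism for the vee^k
   with x |-> x (x) 1 + 1 (x) x *)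
Fixpoint deltaT (t : mtree) : {malg K[(mtree * mtree)%type]} :=
  match t with
  | MLeaf x => << (MLeaf x, one) >> + << (one, MLeaf x) >>
  | MNode ts => vee_tens (map deltaT ts)
  end.

Definition Delta_a (f : {malg K[mtree]}) : {malg K[(mtree * mtree)%type]} :=
  lift deltaT f.

Definition counitA (f : {malg K[mtree]}) : K := f@_one.

(* the space A: K{X}_oo (P = ismon) or K{X} (P = isbin) *)
Definition inA (P : pred mtree) (f : {malg K[mtree]}) : Prop :=
  forall t, t \in msupp f -> P t.

Definition homogA (d : nat) (f : {malg K[mtree]}) : Prop :=
  forall t, t \in msupp f -> deg t = d.

Definition primitive (f : {malg K[mtree]}) : Prop :=
  Delta_a f = tens f << one >> + tens << one >> f.

(* W : primitive elements of A of positive degree *)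
Definition inW (P : pred mtree) (f : {malg K[mtree]}) : Prop :=
  [/\ inA P f, primitive f & counitA f = 0].

(* tensor coalgebra T(A) = free module on sequences of monomials,
   the sequence [:: t1; ...; tn] standing for t1 (x) ... (x) tn *)
Notation TA := {malg K[seq mtree]}.

(* W^{(x) n} inside A^{(x) n} : span of w1 (x) ... (x) wn, wi in W *)
Inductive inTW (P : pred mtree) (n : nat) : TA -> Prop :=
  | inTW0 : inTW P n 0
  | inTWadd (c : TA) (k : K) (ws : seq {malg K[mtree]}) :
      size ws = n -> (forall w, w \in ws -> inW P w) -> inTW P n c ->
      inTW P n (c + k *: expand ws).

Definition tcomp (n : nat) (c : TA) : TA :=
  \sum_(u <- msupp c | size u == n) << c@_u *g u >>.

Definition symmetric (c : TA) : Prop :=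
  forall u v : seq mtree, perm_eq u v -> c@_u = c@_v.

Definition inC (P : pred mtree) (c : TA) : Prop :=
  symmetric c /\ forall n, inTW P n (tcomp n c).

Definition deltaDec (c : TA) : {malg K[(seq mtree * seq mtree)%type]} :=
  lift (fun u => \sum_(i < (size u).+1) << (take i u, drop i u) >>) c.

Definition counitT (c : TA) : K := c@_[::].

Definition homogT (d : nat) (c : TA) : Prop :=
  forall u, u \in msupp c -> sumn (map deg u) = d.

Definition tensmap (phi psi : {malg K[mtree]} -> TA)
  (z : {malg K[(mtree * mtree)%type]}) : {malg K[(seq mtree * seq mtree)%type]} :=
  lift (fun p => tens (phi << p.1 >>) (psi << p.2 >>)) z.

End Algebra.

(* Main.v *)
(* Let Psi = mu o Delta_a, where mu is the binary grafting product.  As Delta_a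
   is coassociative and cocommutative and mu is a morphism of coalgebras, Psi is
   a coalgebra endomorphism of A, equal to 2 on W.  By induction on the degree,
   (Psi - 4)(Psi - 8)...(Psi - 2^d) maps the degree d part A_d into W: the
   eigenvalues of Psi (x) Psi on A_i (x) A_(d-i) with 0 < i < d are among
   4, ..., 2^d, so this operator kills the reduced coproduct.  Dividing by
   (2 - 4)...(2 - 2^d) gives a graded projection pi of A onto W, and phi is the
   sum over n of pi^(x)n composed with the iterated coproduct.  It is a morphism
   of coalgebras with symmetric values, and is injective because it is so on
   primitive elements.  For w1, ..., wn in W, the tensor components of degree
   > n of phi(w1(w2(...wn))) vanish and the one of degree n is the sum of all
   permutations of w1 (x) ... (x) wn; in characteristic 0 surjectivity follows
   by induction on n. *)

Require Import Defs.
From HB Require Import structures.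
From mathcomp Require Import all_boot all_order all_algebra.
From mathcomp Require Import finmap.
From mathcomp.multinomials Require Import monalg.
Import Defs.

Set Implicit Arguments.
Unset Strict Implicit.
Unset Printing Implicit Defensive.

Import GRing.Theory.
Local Open Scope ring_scope.

(** * Linear maps of free modules given on the basis *)

(** On symmetric tensors a coalgebra endomorphism equal to 2 on W is multiplication by 2^n in tensor
    degree n, and since W has positive degree a tensor of degree n has at least n leaves. This is
    the origin of the eigenvalues 2, ..., 2^d on A_d, and the reason why projecting onto the
    eigenvalue 2 should give W before the isomorphism is known. The grafting product is not
    associative; only its unit and its compatibility with [Delta_a] matter. Forming [Psi] with the
    binary product, even in K{X}_oo, lets one argument serve both algebras: both sets of monomials
    are stable under this product and under restriction of trees to sets of leaves. Characteristic 0
    enters through the denominators 2 - 2^k, k >= 2, and n!. Membership in W^(x)n is expressed by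
    tensors of elements of W, symmetry by coefficients of words of monomials. The two meet in a
    symmetrisation defined on words, which is n! on symmetric tensors. *)

Section Lift.
Variable K : fieldType.
Implicit Types S T U : choiceType.

Lemma liftE S T (F : S -> {malg K[T]}) f :
  lift F f = \sum_(s <- msupp f) f@_s *: F s.
Proof. by []. Qed.

Lemma lift_big S T (F : S -> {malg K[T]}) (d : {fset S}) f :
  (msupp f `<=` d)%fset -> lift F f = \sum_(s <- d) f@_s *: F s.
Proof.
move=> le; rewrite /lift (big_fset_incl _ le) //= => s _ /mcoeff_outdom ->.
by rewrite scale0r.
Qed.

Fact lift_is_linear S T (F : S -> {malg K[T]}) : linear (lift F).
Proof.
move=> k f g; pose d := (msupp f `|` msupp g)%fset.
rewrite !(@lift_big _ _ _ d) ?fsubsetUl ?fsubsetUr //; last first.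
  by rewrite (fsubset_trans (msuppD_le _ _)) // fsetSU // msuppZ_le.
rewrite scaler_sumr -big_split; apply: eq_bigr => s _ /=.
by rewrite mcoeffD mcoeffZ scalerDl scalerA.
Qed.

HB.instance Definition _ S T (F : S -> {malg K[T]}) :=
  GRing.isLinear.Build K {malg K[S]} {malg K[T]} *:%R (lift F)
    (lift_is_linear F).

Lemma lift_add S T (F : S -> {malg K[T]}) f g :
  lift F (f + g) = lift F f + lift F g.
Proof. exact: (linearD (lift F)). Qed.

Lemma lift_scale S T (F : S -> {malg K[T]}) k f : lift F (k *: f) = k *: lift F f.
Proof. by rewrite linearZ. Qed.

Lemma lift_big_sum S T (F : S -> {malg K[T]}) (I : Type) (r : seq I)
    (Q : pred I) (f : I -> {malg K[S]}) :
  lift F (\sum_(i <- r | Q i) f i) = \sum_(i <- r | Q i) lift F (f i).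
Proof. exact: (linear_sum (lift F)). Qed.

Lemma malgUZ S (k : K) (s : S) : << k *g s >> = k *: << s >>.
Proof. by apply/malgP => x; rewrite mcoeffZ !mcoeffU mulrnAr mulr1. Qed.

Lemma liftU S T (F : S -> {malg K[T]}) s : lift F << s >> = F s.
Proof.
by rewrite (lift_big _ msuppU_le) big_seq_fset1 mcoeffUU scale1r.
Qed.

Lemma linear_lift S T (L : {linear {malg K[S]} -> {malg K[T]}}) f :
  L f = lift (fun s => L << s >>) f.
Proof.
rewrite {1}[f]monalgE linear_sum; apply: eq_bigr => s _ /=.
by rewrite malgUZ linearZ.
Qed.

Lemma eq_lift S T (F G : S -> {malg K[T]}) f :
  (forall s, s \in msupp f -> F s = G s) -> lift F f = lift G f.
Proof. by move=> eqFG; apply: eq_big_seq => s /eqFG ->. Qed.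

Lemma lift_id S (f : {malg K[S]}) : lift (fun s => << s >>) f = f.
Proof. by rewrite [RHS]monalgE; apply: eq_bigr => s _; rewrite -malgUZ. Qed.

Lemma raddf_lift S T U (L : {linear {malg K[T]} -> {malg K[U]}})
    (F : S -> {malg K[T]}) f : L (lift F f) = lift (fun s => L (F s)) f.
Proof. by rewrite linear_sum; apply: eq_bigr => s _ /=; rewrite linearZ. Qed.

Lemma lift_lift S T U (G : T -> {malg K[U]}) (F : S -> {malg K[T]}) f :
  lift G (lift F f) = lift (fun s => lift G (F s)) f.
Proof. exact: (raddf_lift (lift G)). Qed.

Lemma liftD S T (F G : S -> {malg K[T]}) f :
  lift (fun s => F s + G s) f = lift F f + lift G f.
Proof. by rewrite /lift -big_split; apply: eq_bigr => s _; rewrite scalerDr. Qed.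

Lemma liftZ S T (k : K) (F : S -> {malg K[T]}) f :
  lift (fun s => k *: F s) f = k *: lift F f.
Proof.
by rewrite /lift scaler_sumr; apply: eq_bigr => s _; rewrite !scalerA mulrC.
Qed.

Lemma lift0 S T (f : {malg K[S]}) : lift (fun=> 0 : {malg K[T]}) f = 0.
Proof. by rewrite /lift big1 // => s _; rewrite scaler0. Qed.

Lemma lift_sum S T (I : Type) (r : seq I) (Q : pred I)
    (F : I -> S -> {malg K[T]}) f :
  lift (fun s => \sum_(i <- r | Q i) F i s) f =
  \sum_(i <- r | Q i) lift (F i) f.
Proof.
rewrite exchange_big; apply: eq_bigr => s _ /=; exact: scaler_sumr.
Qed.

Lemma exchange_lift S T U (H : S -> T -> {malg K[U]}) f g :
  lift (fun s => lift (H s) g) f = lift (fun t => lift (H^~ t) f) g.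
Proof. by rewrite lift_sum; apply: eq_bigr => t _ /=; rewrite liftZ. Qed.

Lemma mcoeff_lift S T (F : S -> {malg K[T]}) f x :
  (lift F f)@_x = \sum_(s <- msupp f) f@_s * (F s)@_x.
Proof. by rewrite raddf_sum; apply: eq_bigr => s _ /=; rewrite mcoeffZ. Qed.

Lemma tens_lift S T (u : {malg K[S]}) (v : {malg K[T]}) :
  tens u v = lift (fun a => lift (fun b => << (a, b) >>) v) u.
Proof.
apply: eq_bigr => a _; rewrite scaler_sumr; apply: eq_bigr => b _.
by rewrite malgUZ scalerA.
Qed.

Lemma lift_tens S T U (H : S * T -> {malg K[U]}) u v :
  lift H (tens u v) = lift (fun a => lift (fun b => H (a, b)) v) u.
Proof.
rewrite tens_lift lift_lift; apply: eq_lift => a _.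
by rewrite lift_lift; apply: eq_lift => b _; rewrite liftU.
Qed.

Fact tens_is_linear S T (u : {malg K[S]}) : linear (@tens K S T u).
Proof.
move=> k v w; rewrite !tens_lift -liftZ -liftD.
by apply: eq_lift => a _; rewrite linearP.
Qed.

HB.instance Definition _ S T (u : {malg K[S]}) :=
  GRing.isLinear.Build K {malg K[T]} {malg K[(S * T)%type]} *:%R (tens u)
    (@tens_is_linear S T u).

Lemma tensDl S T (u v : {malg K[S]}) (w : {malg K[T]}) :
  tens (u + v) w = tens u w + tens v w.
Proof. by rewrite !tens_lift linearD. Qed.

Lemma tensZl S T k (u : {malg K[S]}) (w : {malg K[T]}) :
  tens (k *: u) w = k *: tens u w.
Proof. by rewrite !tens_lift linearZ. Qed.

Lemma tensBl S T (u v : {malg K[S]}) (w : {malg K[T]}) :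
  tens (u - v) w = tens u w - tens v w.
Proof. by rewrite !tens_lift linearB. Qed.

Lemma tensDr S T (u : {malg K[S]}) (v w : {malg K[T]}) :
  tens u (v + w) = tens u v + tens u w.
Proof. exact: (linearD (tens u)). Qed.

Lemma tensBr S T (u : {malg K[S]}) (v w : {malg K[T]}) :
  tens u (v - w) = tens u v - tens u w.
Proof. exact: (linearB (tens u)). Qed.

Lemma tensZr S T k (u : {malg K[S]}) (w : {malg K[T]}) :
  tens u (k *: w) = k *: tens u w.
Proof. by rewrite linearZ. Qed.

Lemma tens0l S T (w : {malg K[T]}) : tens (0 : {malg K[S]}) w = 0.
Proof. by rewrite !tens_lift linear0. Qed.

Lemma tens_suml S T (I : Type) (r : seq I) (Q : pred I)
    (F : I -> {malg K[S]}) (w : {malg K[T]}) :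
  tens (\sum_(i <- r | Q i) F i) w = \sum_(i <- r | Q i) tens (F i) w.
Proof. by rewrite tens_lift linear_sum; apply: eq_bigr => i _; rewrite tens_lift. Qed.

Lemma tensUU S T (s : S) (t : T) :
  tens << s >> << t >> = << (s, t) >> :> {malg K[(S * T)%type]}.
Proof. by rewrite tens_lift !liftU. Qed.

Lemma tensUr S T (f : {malg K[S]}) (t : T) :
  tens f << t >> = lift (fun a => << (a, t) >>) f.
Proof. by rewrite tens_lift; apply: eq_lift => a _; apply: liftU. Qed.

Lemma tensUl S T (s : S) (f : {malg K[T]}) :
  tens << s >> f = lift (fun b => << (s, b) >>) f.
Proof. by rewrite tens_lift; apply: liftU. Qed.

Lemma mcoeff_tens S T (u : {malg K[S]}) (v : {malg K[T]}) a b :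
  (tens u v)@_(a, b) = u@_a * v@_b.
Proof.
rewrite [u in RHS]monalgE [v in RHS]monalgE !raddf_sum /= mulr_suml.
apply: eq_bigr => x _; rewrite raddf_sum mulr_sumr /=.
apply: eq_bigr => y _; rewrite !mcoeffU xpair_eqE.
by case: eqP; case: eqP; rewrite ?mulr1n ?mulr0n ?mulr0 ?mul0r.
Qed.

End Lift.

(** * Elements supported on a given set of basis vectors *)

Section Supported.
Variables (K : fieldType) (S : choiceType).

(** [inA], [homogA] and [homogT] are instances up to conversion, so the closure lemmas below apply
    to all three. *)
Definition supported (Q : S -> Prop) (f : {malg K[S]}) : Prop :=
  forall s, s \in msupp f -> Q s.

Variable Q : S -> Prop.

Lemma supported0 : supported Q 0.
Proof. by move=> s; rewrite msupp0. Qed.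

Lemma supportedU s : Q s -> supported Q << s >>.
Proof. by move=> Qs t /(fsubsetP msuppU_le); rewrite inE => /eqP->. Qed.

Lemma supportedD f g : supported Q f -> supported Q g -> supported Q (f + g).
Proof.
move=> Qf Qg s /(fsubsetP (msuppD_le _ _)); rewrite inE.
by case/orP; [apply: Qf | apply: Qg].
Qed.

Lemma supportedZ k f : supported Q f -> supported Q (k *: f).
Proof. by move=> Qf s /(fsubsetP (msuppZ_le _ _)); apply: Qf. Qed.

Lemma supported_sum (I : eqType) (r : seq I) (F : I -> {malg K[S]}) :
  (forall i, i \in r -> supported Q (F i)) -> supported Q (\sum_(i <- r) F i).
Proof.
move=> QF; rewrite big_seq; apply: big_ind => //; [exact: supported0|].
exact: supportedD.
Qed.

Lemma supported_lift (T : choiceType) (F : T -> {malg K[S]}) f :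
  (forall t, t \in msupp f -> supported Q (F t)) -> supported Q (lift F f).
Proof. by move=> QF; apply: supported_sum => t /QF; apply: supportedZ. Qed.

End Supported.

(** * Products of the operators T - 2^k *)

Section Strip.
Variables (K : fieldType) (V : lmodType K).

(* The operator \prod_(s < k <= s + n) (T - 2 ^ k). *)
Fixpoint strip (T : V -> V) (s n : nat) (x : V) : V :=
  if n is m.+1 then strip T s m (T x - 2%:R ^+ (s + n) *: x) else x.

Fact strip_is_linear (T : {linear V -> V}) s n : linear (strip T s n).
Proof.
elim: n => [|n IHn] k x y //; rewrite -[LHS]/(strip T s n _) -IHn.
congr (strip T s n _); rewrite linearP !scalerDr opprD scalerN.
by rewrite !scalerA [_ * k]mulrC addrACA.
Qed.

HB.instance Definition _ (T : {linear V -> V}) s n :=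
  GRing.isLinear.Build K V V *:%R (strip T s n) (strip_is_linear T s n).

Lemma strip_comm (T : {linear V -> V}) s n x :
  strip T s n (T x) = T (strip T s n x).
Proof.
elim: n x => //= n IHn x; rewrite -IHn; congr (strip T s n _).
by rewrite linearB [T (_ *: _)]linearZ.
Qed.

(** The largest exponent is applied first, so the lowest factor is outermost and splits off for any
    map [T]; [stripS_top] has to commute factors and takes [T] linear. This lemma relates s = 1,
    which leaves the eigenvalue 2, to s = 0, which kills it too. *)
Lemma stripS_bottom T s n x :
  strip T s n.+1 x =
  T (strip T s.+1 n x) - 2%:R ^+ s.+1 *: strip T s.+1 n x.
Proof.
elim: n x => [|n IHn] x; first by rewrite /= addn1.
by rewrite -[LHS]/(strip T s n.+1 _) IHn /= addSnnS.
Qed.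

Lemma stripS_top (T : {linear V -> V}) s n x :
  strip T s n.+1 x = T (strip T s n x) - 2%:R ^+ (s + n.+1) *: strip T s n x.
Proof. by rewrite -strip_comm /= linearB; congr (_ - _); apply: linearZ. Qed.

Lemma strip_eigen (T : {linear V -> V}) s n x k : T x = k *: x ->
  strip T s n x = (\prod_(i < n) (k - 2%:R ^+ (s + i.+1))) *: x.
Proof.
move=> Tx; elim: n => [|n IHn]; first by rewrite big_ord0 scale1r.
rewrite stripS_top IHn linearZ /= Tx big_ord_recr /= !scalerA -scalerBl.
by rewrite mulrBr [_ * (2%:R ^+ _)]mulrC.
Qed.

Lemma strip_closed (Q : V -> Prop) (T : V -> V) s n x :
  (forall k y z, Q y -> Q z -> Q (y + k *: z)) -> (forall y, Q y -> Q (T y)) ->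
  Q x -> Q (strip T s n x).
Proof.
move=> Qlin QT; elim: n x => //= n IHn x Qx; apply: IHn.
by rewrite -scaleNr; apply: Qlin => //; apply: QT.
Qed.

End Strip.

Lemma strip_morph (K : fieldType) (V V' : lmodType K) (L : {linear V -> V'})
    (T : V -> V) (T' : V' -> V') s n x :
  (forall y, L (T y) = T' (L y)) -> L (strip T s n x) = strip T' s n (L x).
Proof.
by move=> LT; elim: n x => //= n IHn x; rewrite IHn linearB linearZ LT.
Qed.

(** * Tensor products of linear maps *)

Section TensorMap.
Variables (K : fieldType) (S T S' T' : choiceType).

Lemma tens_liftl (U : choiceType) (F : S -> {malg K[S']}) u (w : {malg K[U]}) :
  tens (lift F u) w = lift (fun a => tens (F a) w) u.
Proof.
by rewrite tens_lift lift_lift; apply: eq_lift => a _; rewrite tens_lift.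
Qed.

Lemma tensmap_tens (F : S -> {malg K[S']}) (G : T -> {malg K[T']}) u v :
  lift (fun p => tens (F p.1) (G p.2)) (tens u v) = tens (lift F u) (lift G v).
Proof.
rewrite lift_tens tens_liftl; apply: eq_lift => a _.
by rewrite (raddf_lift (tens (F a))).
Qed.

End TensorMap.

(* The tensor square of T - 2^(i+j) is
   (T - 2^i) (x) T + 2^i (1 (x) (T - 2^j)). *)
Lemma strip_tens (K : fieldType) (S : choiceType) (F : S -> {malg K[S]})
    i j (a b : {malg K[S]}) :
  strip (lift F) 0 i a = 0 -> strip (lift F) 0 j b = 0 ->
  strip (lift (fun p => tens (F p.1) (F p.2))) 1 (i + j).-1 (tens a b) = 0.
Proof.
set F2 := fun p => _.
(* Each factor lowers i or j by one, and an index 0 forces a = 0 or b = 0. This happens at the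
   latest when i + j = 1, so the exponents 2, ..., i + j suffice. *)
have [n] := ubnP (i + j); elim: n i j a b => // n IHn [|i] [|j] a b lt_n.
- by move=> a0 _; rewrite (a0 : a = 0) tens0l linear0.
- by move=> a0 _; rewrite (a0 : a = 0) tens0l linear0.
- by move=> _ b0; rewrite (b0 : b = 0) !linear0.
move=> ai bj; rewrite addSn addnS /=.
have -> : lift F2 (tens a b) - 2%:R ^+ (1 + (i + j).+1) *: tens a b =
    tens (lift F a - 2%:R ^+ i.+1 *: a) (lift F b) +
    2%:R ^+ i.+1 *: tens a (lift F b - 2%:R ^+ j.+1 *: b).
  rewrite tensmap_tens tensBl tensZl tensBr tensZr scalerBr addrA subrK.
  by rewrite scalerA -exprD !addSn !addnS add0n.
have lt1 : (i + j.+1 < n)%N by rewrite -ltnS -addSn.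
have lt2 : (i.+1 + j < n)%N by rewrite addSnnS.
have bj' : strip (lift F) 0 j.+1 (lift F b) = 0.
  by rewrite strip_comm bj linear0.
have eq1 := IHn i j.+1 _ _ lt1 ai bj'; rewrite addnS /= in eq1.
have eq2 := IHn i.+1 j _ _ lt2 ai bj; rewrite addSn /= in eq2.
by rewrite [LHS]linearD [X in _ + X]linearZ /= eq1 eq2 scaler0 addr0.
Qed.

(** * The co-addition on trees *)

Section Splittings.
Variable X : countType.
Local Notation mtree := (mtree X).
Local Notation one := (one X).

Lemma mtree_nested_ind (Q : mtree -> Prop) :
  (forall x, Q (MLeaf x)) ->
  (forall ts, (forall t, t \in ts -> Q t) -> Q (MNode ts)) ->
  forall t, Q t.
Proof.
move=> Qleaf Qnode; fix IH 1 => -[x | ts]; first exact: Qleaf.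
apply: Qnode; elim: ts => [|t ts IHts] u.
  clear IH; by rewrite in_nil.
have Qt := IH t; clear IH; rewrite in_cons => /predU1P[-> //|]; exact: IHts.
Qed.

Definition pairings (pss : seq (seq (mtree * mtree))) : seq (seq mtree * seq mtree) :=
  foldr (fun ps qs => [seq (p.1 :: q.1, p.2 :: q.2) | p <- ps, q <- qs])
        [:: ([::], [::])] pss.

(* [splitT t] lists the pairs (t restricted to I, t restricted to the
   complement of I), I running through the sets of leaves of t. *)
Fixpoint splitT (t : mtree) : seq (mtree * mtree) :=
  match t with
  | MLeaf x => [:: (MLeaf x, one); (one, MLeaf x)]
  | MNode ts => [seq (veeM q.1, veeM q.2) | q <- pairings (map splitT ts)]
  end.

Definition splitF (ts : seq mtree) := pairings (map splitT ts).

(** Identities between splittings are stated under a sum of an arbitrary [H] with values in a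
    commutative monoid. An induction hypothesis can then be used with a nested sum as its summand,
    and lists never have to be compared up to permutation. *)
Lemma big_splitF_nil (V : nmodType) (H : seq mtree -> seq mtree -> V) :
  \sum_(q <- splitF [::]) H q.1 q.2 = H [::] [::].
Proof. by rewrite big_seq1. Qed.

Lemma big_splitF_cons (V : nmodType) (H : seq mtree -> seq mtree -> V) t ts :
  \sum_(q <- splitF (t :: ts)) H q.1 q.2 =
  \sum_(p <- splitT t) \sum_(q <- splitF ts) H (p.1 :: q.1) (p.2 :: q.2).
Proof. by rewrite big_allpairs_dep. Qed.

Lemma big_splitT_node (V : nmodType) (H : mtree -> mtree -> V) ts :
  \sum_(p <- splitT (MNode ts)) H p.1 p.2 =
  \sum_(q <- splitF ts) H (veeM q.1) (veeM q.2).
Proof. by rewrite big_map. Qed.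

Lemma big_splitT_leaf (V : nmodType) (H : mtree -> mtree -> V) x :
  \sum_(p <- splitT (MLeaf x)) H p.1 p.2 = H (MLeaf x) one + H one (MLeaf x).
Proof. by rewrite big_cons big_seq1. Qed.

Lemma splitT_one : splitT one = [:: (one, one)].
Proof. by []. Qed.

(** Multilinear expansion of the grafting of the [deltaT] of the children runs over the choices of
    one splitting per child. As [veeM] does not recurse along the list, it is hidden in an arbitrary
    [H] for the induction on [ts]. *)
Lemma deltaT_split (K : fieldType) (t : mtree) :
  deltaT K t = \sum_(p <- splitT t) << p >>.
Proof.
elim/mtree_nested_ind: t => [x | ts IH].
  by rewrite big_cons big_seq1.
rewrite -/(splitT _) big_map /= /vee_tens.
pose H (s1 s2 : seq mtree) := << (veeM s1, veeM s2) >> : {malg K[(mtree * mtree)%type]}.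
rewrite -[LHS]/(lift (fun s => H (unzip1 s) (unzip2 s)) _).
rewrite -[RHS]/(\sum_(q <- splitF ts) H q.1 q.2).
elim: ts H IH => [|t ts IHts] H IH; first by rewrite /= liftU big_splitF_nil.
rewrite big_splitF_cons [expand _]/= lift_lift IH ?mem_head // linear_sum.
apply: eq_bigr => p _ /=; rewrite liftU lift_lift.
rewrite -(IHts (fun s1 s2 => H (p.1 :: s1) (p.2 :: s2))); last first.
  by move=> u uts; apply: IH; rewrite in_cons uts orbT.
by apply: eq_lift => s _; rewrite liftU.
Qed.

Definition nontriv (s : seq mtree) := [seq t <- s | t != one].

Lemma veeM_nontriv (s : seq mtree) : veeM (nontriv s) = veeM s.
Proof. by rewrite /veeM /nontriv filter_id. Qed.

Lemma veeM_ge2 (s : seq mtree) :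
  all (fun t => t != one) s -> (1 < size s)%N -> veeM s = MNode s.
Proof. by rewrite /veeM => /all_filterP ->; case: s => [|a [|b s]]. Qed.

Lemma veeM_seq1 (t : mtree) : veeM [:: t] = t.
Proof. by rewrite /veeM /=; case: eqP. Qed.

(** The empty tree splits only as [(one, one)], so its occurrences in [s] disappear from both
    components. *)
Lemma big_splitF_nontriv (V : nmodType) (H : seq mtree -> seq mtree -> V) s :
  \sum_(q <- splitF s) H (nontriv q.1) (nontriv q.2) =
  \sum_(q <- splitF (nontriv s)) H (nontriv q.1) (nontriv q.2).
Proof.
pose H' s1 s2 := H (nontriv s1) (nontriv s2).
elim: s H @H' => [|t s IHs] H H' //.
rewrite (big_splitF_cons H') /= (fun_if splitF); case: (t =P one) => [->|_] /=.
  by rewrite big_seq1; apply: IHs.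
rewrite (big_splitF_cons H'); apply: eq_bigr => p _.
exact: (IHs (fun s1 s2 => H (if p.1 != one then p.1 :: s1 else s1)
                            (if p.2 != one then p.2 :: s2 else s2))).
Qed.

(** The co-addition is a homomorphism also when the unit conventions apply. [splitT] recurses on
    actual nodes, whereas [veeM s] may be [one], a single tree or a node; these are the three cases
    once trivial trees are dropped. *)
Lemma big_splitT_veeM (V : nmodType) (H : mtree -> mtree -> V) s :
  \sum_(p <- splitT (veeM s)) H p.1 p.2 =
  \sum_(q <- splitF s) H (veeM q.1) (veeM q.2).
Proof.
under [RHS]eq_bigr => q _ do rewrite -[veeM q.1]veeM_nontriv -[veeM q.2]veeM_nontriv.
rewrite (big_splitF_nontriv (fun s1 s2 => H (veeM s1) (veeM s2))) -veeM_nontriv.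
under [RHS]eq_bigr => q _ do rewrite !veeM_nontriv.
have := filter_all (fun t => t != one) s; rewrite -/(nontriv s).
case: (nontriv s) => [|a [|b r]] all_s.
- by rewrite (big_splitF_nil (fun s1 s2 => H (veeM s1) (veeM s2))) big_seq1.
- rewrite (big_splitF_cons (fun s1 s2 => H (veeM s1) (veeM s2))) veeM_seq1.
  apply: eq_bigr => p _.
  pose H' s1 s2 := H (veeM (p.1 :: s1)) (veeM (p.2 :: s2)).
  by rewrite (big_splitF_nil H') /H' !veeM_seq1.
- by rewrite veeM_ge2 // (big_splitT_node H).
Qed.

(** Cocommutativity: a set of leaves is exchanged with its complement. *)
Lemma big_splitT_sym (V : nmodType) (H : mtree -> mtree -> V) t :
  \sum_(p <- splitT t) H p.1 p.2 = \sum_(p <- splitT t) H p.2 p.1.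
Proof.
elim/mtree_nested_ind: t V H => [x | ts IH] V H.
  by rewrite (big_splitT_leaf H) (big_splitT_leaf (fun a b => H b a)) addrC.
rewrite (big_splitT_node H) (big_splitT_node (fun a b => H b a)).
pose G (s1 s2 : seq mtree) := H (veeM s1) (veeM s2).
rewrite -[LHS]/(\sum_(q <- splitF ts) G q.1 q.2) -[RHS]/(\sum_(q <- splitF ts) G q.2 q.1).
elim: ts G IH => [|t ts IHts] G IH; first by rewrite !big_seq1.
rewrite (big_splitF_cons G) (big_splitF_cons (fun a b => G b a)).
rewrite (IH _ (mem_head _ _) _ (fun a b => \sum_(q <- splitF ts) G (a :: q.1) (b :: q.2))).
apply: eq_bigr => p _; apply: (IHts (fun s1 s2 => G (p.2 :: s1) (p.1 :: s2))).
by move=> u uts; apply: IH; rewrite in_cons uts orbT.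
Qed.

(** Coassociativity: both sides run over the partitions of the leaves into three labelled parts. *)
Lemma big_splitT_assoc (V : nmodType) (H : mtree -> mtree -> mtree -> V) t :
  \sum_(p <- splitT t) \sum_(q <- splitT p.2) H p.1 q.1 q.2 =
  \sum_(p <- splitT t) \sum_(q <- splitT p.1) H q.1 q.2 p.2.
Proof.
elim/mtree_nested_ind: t V H => [x | ts IH] V H.
  rewrite !(big_cons, big_nil) /= !addr0 addrA; congr (_ + _).
rewrite (big_splitT_node (fun a b => \sum_(q <- splitT b) H a q.1 q.2)).
rewrite (big_splitT_node (fun a b => \sum_(q <- splitT a) H q.1 q.2 b)).
under eq_bigr => p _ do rewrite big_splitT_veeM.
under [RHS]eq_bigr => p _ do rewrite (big_splitT_veeM (fun a b => H a b _)).
pose G (s1 s2 s3 : seq mtree) := H (veeM s1) (veeM s2) (veeM s3).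
rewrite -[LHS]/(\sum_(p <- splitF ts) \sum_(q <- splitF p.2) G p.1 q.1 q.2).
rewrite -[RHS]/(\sum_(p <- splitF ts) \sum_(q <- splitF p.1) G q.1 q.2 p.2).
elim: ts G IH => [|t ts IHts] G IH.
  by rewrite !big_seq1.
rewrite (big_splitF_cons (fun a b => \sum_(q <- splitF b) G a q.1 q.2)).
rewrite (big_splitF_cons (fun a b => \sum_(q <- splitF a) G q.1 q.2 b)).
under eq_bigr => p _.
  under eq_bigr => q _ do rewrite big_splitF_cons.
  rewrite exchange_big /=; over.
rewrite (IH _ (mem_head _ _) _ (fun a b c => \sum_(i <- splitF ts)
  \sum_(q <- splitF i.2) G (a :: i.1) (b :: q.1) (c :: q.2))).
apply: eq_bigr => p _.
under [RHS]eq_bigr => q _ do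
  rewrite (big_splitF_cons (fun a b => G a b (p.2 :: q.2))).
rewrite [RHS]exchange_big /=; apply: eq_bigr => r _.
apply: (IHts (fun s1 s2 s3 => G (r.1 :: s1) (r.2 :: s2) (p.2 :: s3))).
by move=> u uts; apply: IH; rewrite in_cons uts orbT.
Qed.

(** By coassociativity the two middle factors become the two parts of one tree, where
    cocommutativity swaps them. *)
Lemma big_splitT_mid (V : nmodType) (H : mtree -> mtree -> mtree -> mtree -> V) t :
  \sum_(p <- splitT t) \sum_(q <- splitT p.1) \sum_(r <- splitT p.2)
    H q.1 q.2 r.1 r.2 =
  \sum_(p <- splitT t) \sum_(q <- splitT p.1) \sum_(r <- splitT p.2)
    H q.1 r.1 q.2 r.2.
Proof.
have regroup G : \sum_(p <- splitT t) \sum_(q <- splitT p.1)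
    \sum_(r <- splitT p.2) G q.1 q.2 r.1 r.2 = \sum_(p <- splitT t)
    \sum_(q <- splitT p.2) \sum_(r <- splitT q.1) G p.1 r.1 r.2 q.2 :> V.
  rewrite -(big_splitT_assoc (fun a b c => \sum_(r <- splitT c) G a b r.1 r.2)).
  by apply: eq_bigr => p _; rewrite (big_splitT_assoc (G p.1)).
rewrite (regroup H) (regroup (fun a b c d => H a c b d)).
apply: eq_bigr => p _; apply: eq_bigr => q _.
exact: (big_splitT_sym (fun a b => H p.1 a b q.2)).
Qed.

Lemma deg_veeM (s : seq mtree) : deg (veeM s) = sumn (map (@deg X) s).
Proof.
rewrite -veeM_nontriv; have -> : sumn (map (@deg X) s) = sumn (map (@deg X) (nontriv s)).
  by elim: s => //= t s ->; case: eqP => // ->.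
have := filter_all (fun t => t != one) s; rewrite -/(nontriv s).
case: (nontriv s) => [|a [|b r]] // all_s; last by rewrite veeM_ge2.
by rewrite veeM_seq1 /= addn0.
Qed.

Lemma all_splitF (Q : pred mtree) ts q : q \in splitF ts ->
  (forall t p, t \in ts -> p \in splitT t -> Q p.1 && Q p.2) ->
  [/\ size q.1 = size ts, size q.2 = size ts, all Q q.1 & all Q q.2].
Proof.
elim: ts q => [|t ts IHts] q; first by rewrite inE => /eqP->.
case/allpairsP => -[p r] /= [pt rts ->] Qts /=.
have [|-> -> -> ->] := IHts r rts.
  by move=> u p' uts; apply: Qts; rewrite in_cons uts orbT.
by have /andP[-> ->] := Qts t p (mem_head _ _) pt.
Qed.

Lemma splitT_deg t p : p \in splitT t -> (deg p.1 + deg p.2)%N = deg t.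
Proof.
elim/mtree_nested_ind: t p => [x | ts IH] p; first by rewrite !inE => /orP[]/eqP->.
case/mapP => q + ->; rewrite /= !deg_veeM -/(splitF ts).
elim: ts q IH => [|t ts IHts] q IH; first by rewrite inE => /eqP->.
case/allpairsP => -[p' r] /= [pt rts ->] /=.
have IHts' u : u \in ts -> forall p0, p0 \in splitT u -> (deg p0.1 + deg p0.2)%N = deg u.
  by move=> uts; apply: IH; rewrite in_cons uts orbT.
by rewrite addnACA (IHts _ IHts' rts) (IH t (mem_head _ _) _ pt).
Qed.

Lemma isred_neq1 (t : mtree) : isred t -> t != one.
Proof. by apply: contraTneq => ->. Qed.

Lemma isbintree_red (t : mtree) : isbintree t -> isred t.
Proof.
elim/mtree_nested_ind: t => [//| ts IH] /=.
case/andP => /eqP -> /allP h /=; apply/allP => t tts; apply: IH => //; exact: h.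
Qed.

Lemma isred_deg (t : mtree) : isred t -> (0 < deg t)%N.
Proof.
elim/mtree_nested_ind: t => [//| [|t ts] IH] //= /andP[_ /andP[tr _]].
by rewrite addn_gt0 IH ?mem_head.
Qed.

End Splittings.

(** * Reduced and binary monomials, and the counit axiom *)

Section Monomials.
Variable X : countType.
Local Notation mtree := (mtree X).
Local Notation one := (one X).

Lemma veeM_eq1 (s : seq mtree) : (veeM s == one) = all (pred1 one) s.
Proof.
rewrite -veeM_nontriv; have -> : all (pred1 one) s = (nontriv s == [::]).
  by rewrite /nontriv; elim: s => //= t s ->; case: eqP.
have := filter_all (fun t => t != one) s; rewrite -/(nontriv s).
case: (nontriv s) => [//|a [|b r]] all_s; last by rewrite veeM_ge2 //; case: eqP.
by rewrite veeM_seq1; move: all_s => /andP[/negbTE->].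
Qed.

Lemma veeM_ismon (s : seq mtree) : all (@ismon X) s -> ismon (veeM s).
Proof.
move=> all_s; rewrite -veeM_nontriv.
have: all (@isred X) (nontriv s).
  apply/allP => t; rewrite mem_filter => /andP[t_n1 /(allP all_s)].
  by rewrite /ismon (negbTE t_n1).
case: (nontriv s) => [|a [|b r]] // red_s.
  by rewrite veeM_seq1 /ismon (allP red_s) ?mem_head ?orbT.
have n1_s : all (fun t => t != one) (a :: b :: r).
  by apply: sub_all red_s => t /isred_neq1.
by rewrite veeM_ge2 // /ismon; move: red_s => /= ->; rewrite orbT.
Qed.

Lemma veeM_isbin (s : seq mtree) :
  (size s <= 2)%N -> all (@isbin X) s -> isbin (veeM s).
Proof.
move=> le2 all_s; rewrite -veeM_nontriv.
have: all (@isbintree X) (nontriv s).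
  apply/allP => t; rewrite mem_filter => /andP[t_n1 /(allP all_s)].
  by rewrite /isbin (negbTE t_n1).
have: (size (nontriv s) <= 2)%N.
  by rewrite size_filter (leq_trans (count_size _ _)).
case: (nontriv s) => [|a [|b [|c r]]] // _ bin_s.
  by rewrite veeM_seq1 /isbin (allP bin_s) ?mem_head ?orbT.
have n1_s : all (fun t => t != one) [:: a; b].
  by apply: sub_all bin_s => t /isbintree_red /isred_neq1.
by rewrite veeM_ge2 // /isbin; move: bin_s => /= ->; rewrite orbT.
Qed.

(** The two algebras are told apart only in the proofs of [mons1], [mons_ismon], [mons_veeM2] and
    [mons_split]. *)
Definition mons (binary : bool) : pred mtree :=
  if binary then @isbin X else @ismon X.

Variable binary : bool.
Local Notation P := (mons binary).

Lemma mons1 : P one.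
Proof. by rewrite /mons; case: binary. Qed.

Lemma mons_ismon t : P t -> ismon t.
Proof.
rewrite /mons; case: binary => //; rewrite /isbin /ismon.
by case/orP => [->|/isbintree_red->] //; rewrite orbT.
Qed.

Lemma mons_veeM2 a b : P a -> P b -> P (veeM [:: a; b]).
Proof.
rewrite /mons; case: binary => Pa Pb; first by apply: veeM_isbin => //=; rewrite Pa Pb.
by apply: veeM_ismon; rewrite /= Pa Pb.
Qed.

Lemma mons_split t p : P t -> p \in splitT t -> P p.1 && P p.2.
Proof.
elim/mtree_nested_ind: t p => [x | ts IH] p Pt.
  by rewrite !inE => /orP[]/eqP-> /=; rewrite ?mons1 ?Pt.
case/mapP => q; rewrite -/(splitF ts) => q_ts -> /=.
have sub t : P (MNode ts) -> t \in ts -> P t.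
  by rewrite /mons /isbin /ismon; case: binary => /predU1P[[->] //|/=];
    case/andP=> _ /allP red_ts /red_ts ->; rewrite orbT.
have [s1 s2 P1 P2] := all_splitF q_ts (fun t p tts => IH t tts p (sub t Pt tts)).
move: P1 P2 Pt; rewrite /mons; case: binary => P1 P2 Pt; last by rewrite !veeM_ismon.
(* A binary vertex has two children; the empty tree, also an [MNode], has none. *)
have ts_le2 : (size ts <= 2)%N by case/predU1P: Pt => [[->]|/andP[/eqP->]].
by rewrite !veeM_isbin ?s1 ?s2.
Qed.

Lemma mons_deg_eq0 t : P t -> (deg t == 0)%N = (t == one).
Proof.
move/mons_ismon; case: (t =P one) => [-> //|/eqP t_n1].
by rewrite /ismon (negbTE t_n1) /= => /isred_deg; rewrite lt0n => /negbTE.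
Qed.

(** The only splitting with empty first part sends every leaf to the right. It returns [t] itself
    because [t] is reduced: [veeM] would contract a vertex with one child. *)
Lemma big_splitT_counit (V : nmodType) (H : mtree -> V) t : P t ->
  \sum_(p <- splitT t | p.1 == one) H p.2 = H t.
Proof.
rewrite big_mkcond /= => /mons_ismon /predU1P[->|].
  by rewrite splitT_one big_seq1 eqxx.
elim/mtree_nested_ind: t V H => [x | ts IH] V H.
  by rewrite (big_splitT_leaf (fun a b => if a == one then H b else 0)) /= add0r.
case/andP => size_ts red_ts.
rewrite (big_splitT_node (fun a b => if a == one then H b else 0)).
have: all (fun t => t != one) ts by apply: sub_all red_ts => t /isred_neq1.
move/veeM_ge2 => /(_ size_ts) <-; under eq_bigr => q _ do rewrite veeM_eq1.
pose G (s : seq mtree) := H (veeM s).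
rewrite -[LHS]/(\sum_(q <- splitF ts) if all (pred1 one) q.1 then G q.2 else 0).
rewrite -[RHS]/(G ts); elim: ts G IH red_ts {size_ts} => [|t ts IHts] G IH.
  by rewrite (big_splitF_nil (fun s1 s2 => if all (pred1 one) s1 then G s2 else 0)).
case/andP => red_t red_ts.
rewrite (big_splitF_cons (fun s1 s2 => if all (pred1 one) s1 then G s2 else 0)).
rewrite -(IHts (fun s => G (t :: s))) //; last first.
  by move=> u uts; apply: IH; rewrite in_cons uts orbT.
rewrite -(IH t (mem_head _ _) _ (fun u => \sum_(q <- splitF ts)
  (if all (pred1 one) q.1 then G (u :: q.2) else 0))) //.
by apply: eq_bigr => p _ /=; case: eqP => //= _; rewrite big1.
Qed.

End Monomials.

(** * The endomorphism Psi and the projection onto primitive elements *)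

Section Doubling.
Variables (K : fieldType) (X : countType).
Local Notation mtree := (mtree X).
Local Notation one := (one X).
Local Notation A := {malg K[mtree]}.
Local Notation delta := (@deltaT K X).

Lemma lift_deltaT (S : choiceType) (F : mtree * mtree -> {malg K[S]}) t :
  lift F (delta t) = \sum_(p <- splitT t) F p.
Proof. by rewrite deltaT_split linear_sum; apply: eq_bigr => p _ /=; rewrite liftU. Qed.

Definition mulT (a b : mtree) : mtree := veeM [:: a; b].

Lemma mul1T a : mulT one a = a. Proof. by rewrite /mulT /veeM /=; case: eqP. Qed.
Lemma mulT1 a : mulT a one = a. Proof. by rewrite /mulT /veeM /=; case: eqP. Qed.

Lemma deg_mulT a b : deg (mulT a b) = (deg a + deg b)%N.
Proof. by rewrite deg_veeM /= addn0. Qed.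

Lemma big_splitT_mul (V : nmodType) (H : mtree -> mtree -> V) a b :
  \sum_(p <- splitT (mulT a b)) H p.1 p.2 =
  \sum_(q <- splitT a) \sum_(r <- splitT b) H (mulT q.1 r.1) (mulT q.2 r.2).
Proof.
rewrite big_splitT_veeM (big_splitF_cons (fun s1 s2 => H (veeM s1) (veeM s2))).
apply: eq_bigr => q _.
rewrite (big_splitF_cons (fun s1 s2 => H (veeM (_ :: s1)) (veeM (_ :: s2)))).
apply: eq_bigr => r _.
by rewrite (big_splitF_nil (fun s1 s2 => H (veeM [:: _, _ & s1]) (veeM [:: _, _ & s2]))).
Qed.

Definition PsiT (t : mtree) : A := \sum_(p <- splitT t) << mulT p.1 p.2 >>.
Local Notation Psi := (lift PsiT).
Local Notation Psi2 := (lift (fun p => tens (PsiT p.1) (PsiT p.2))).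

Lemma PsiE (f : A) : Psi f = lift (fun p => << mulT p.1 p.2 >>) (lift delta f).
Proof. by rewrite lift_lift; apply: eq_lift => t _; rewrite lift_deltaT. Qed.

Lemma PsiT_one : PsiT one = << one >>.
Proof. by rewrite /PsiT splitT_one big_seq1 mul1T. Qed.

(** Multiplicativity of the co-addition turns both sides into sums over the fourfold coproduct; they
    differ by an exchange of the two middle factors. *)
Lemma lift_PsiT_delta (f : A) : lift delta (Psi f) = Psi2 (lift delta f).
Proof.
rewrite !lift_lift; apply: eq_lift => t _; rewrite lift_deltaT linear_sum /=.
pose H a b c d := << (mulT a b, mulT c d) >> : {malg K[(mtree * mtree)%type]}.
transitivity (\sum_(p <- splitT t) \sum_(q <- splitT p.1)
   \sum_(r <- splitT p.2) H q.1 r.1 q.2 r.2).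
  apply: eq_bigr => p _; rewrite liftU deltaT_split.
  rewrite -(big_splitT_mul (fun a b => << (a, b) >>)).
  by apply: eq_bigr => -[].
rewrite (big_splitT_mid (fun a b c d => H a c b d)).
apply: eq_bigr => p _; rewrite tens_suml; apply: eq_bigr => q _.
by rewrite linear_sum; apply: eq_bigr => r _ /=; rewrite tensUU.
Qed.

Lemma Psi_primitive (f : A) : primitive f -> Psi f = 2%:R *: f.
Proof.
move=> prim_f; pose M (p : mtree * mtree) : A := << mulT p.1 p.2 >>.
have M1 : lift M (tens f << one >>) = f.
  rewrite lift_tens -[RHS]lift_id; apply: eq_lift => a _.
  by rewrite liftU /M mulT1.
have M2 : lift M (tens << one >> f) = f.
  rewrite lift_tens liftU -[RHS]lift_id; apply: eq_lift => a _.
  by rewrite /M mul1T.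
have -> : Psi f = lift M (Delta_a f) by rewrite PsiE.
rewrite prim_f lift_add; apply: etrans (congr2 +%R M1 M2) _.
by rewrite scaler_nat mulr2n.
Qed.

Variable binary : bool.
Local Notation P := (@mons X binary).

Lemma deltaT_reduced t : P t -> t != one -> delta t =
  << (t, one) >> + << (one, t) >> +
  \sum_(p <- splitT t | (p.1 != one) && (p.2 != one)) << p >>.
Proof.
move=> Pt t_n1; rewrite deltaT_split (bigID (fun p => p.1 == one)) /=.
rewrite [X in _ + X](bigID (fun p => p.2 == one)) /= addrA [X in X + _]addrC.
congr (_ + _ + _); last first.
  rewrite -(big_splitT_counit (fun u => << (one, u) >>) Pt).
  by apply: eq_bigr => -[a b] /= /eqP->.
(* The splittings with empty second part follow from the counit axiom by cocommutativity. The extra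
   condition [p.1 != one] is automatic there, the degrees adding up to [deg t > 0]. *)
rewrite -[RHS](big_splitT_counit (fun u => << (u, one) >>) Pt) [RHS]big_mkcond.
rewrite -(big_splitT_sym (fun a b => if b == one then << (a, one) >> else 0)).
rewrite -[RHS]big_mkcond [LHS]big_seq_cond [RHS]big_seq_cond.
apply: eq_big => [p|[a b] /andP[_ /andP[_ /eqP/= ->]] //].
case: (boolP (p \in splitT t)) => //= pt.
case: (p.2 =P one) => [p2|]; last by rewrite andbF.
rewrite andbT; apply: contraNneq t_n1 => p1.
by rewrite -(mons_deg_eq0 Pt) -(splitT_deg pt) p1 p2.
Qed.

Lemma Delta_a_reduced (f : A) : (forall t, t \in msupp f -> P t && (t != one)) ->
  Delta_a f = tens f << one >> + tens << one >> f +
  lift (fun t => \sum_(p <- splitT t | (p.1 != one) && (p.2 != one)) << p >>) f.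
Proof.
move=> Pf; rewrite tensUr tensUl -liftD -liftD; apply: eq_lift => t /Pf/andP[].
exact: deltaT_reduced.
Qed.

Lemma inA_Psi (f : A) : inA P f -> inA P (Psi f).
Proof.
move=> Af; apply: supported_lift => t /Af Pt; apply: supported_sum => p pt.
by apply: supportedU; have /andP[] := mons_split Pt pt; apply: mons_veeM2.
Qed.

Lemma homogA_Psi d (f : A) : homogA d f -> homogA d (Psi f).
Proof.
move=> hf; apply: supported_lift => t /hf dt; apply: supported_sum => p pt.
by apply: supportedU; rewrite deg_mulT (splitT_deg pt).
Qed.

Lemma inA_strip s n (f : A) : inA P f -> inA P (strip Psi s n f).
Proof.
move=> Af; apply: (strip_closed (Q := inA P)) => // [k y z Ay Az|]; last exact: inA_Psi.
by apply: supportedD => //; apply: supportedZ.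
Qed.

Lemma homogA_strip d s n (f : A) : homogA d f -> homogA d (strip Psi s n f).
Proof.
move=> Af; apply: (strip_closed (Q := homogA d)) => // [k y z Ay Az|];
  last exact: homogA_Psi.
by apply: supportedD => //; apply: supportedZ.
Qed.

Lemma counit_homog d (f : A) : homogA d.+1 f -> counitA f = 0.
Proof. by move=> hf; apply: mcoeff_outdom; apply/negP => /hf. Qed.

Lemma Psi_one : Psi << one >> = << one >>.
Proof. exact: etrans (liftU _ _) PsiT_one. Qed.

Lemma strip_tens1 s n (f : A) :
  strip Psi2 s n (tens f << one >>) = tens (strip Psi s n f) << one >>.
Proof.
elim: n f => [//|n IHn] f; apply: etrans (IHn _); congr (strip Psi2 s n _).
rewrite tensBl tensZl; congr (_ - _).
exact: etrans (tensmap_tens _ _ _ _) (congr1 _ Psi_one).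
Qed.

Lemma strip_1tens s n (f : A) :
  strip Psi2 s n (tens << one >> f) = tens << one >> (strip Psi s n f).
Proof.
elim: n f => [//|n IHn] f; apply: etrans (IHn _); congr (strip Psi2 s n _).
rewrite tensBr tensZr; congr (_ - _).
exact: etrans (tensmap_tens _ _ _ _) (congr1 (fun u => tens u _) Psi_one).
Qed.

(* For i + j = d + 1 with i, j > 0, the induction hypothesis makes
   (Psi - 2)...(Psi - 2^i) vanish on A_i, so strip_tens kills A_i (x) A_j. *)
Lemma strip_inW d (f : A) : inA P f -> homogA d.+1 f -> inW P (strip Psi 1 d f).
Proof.
elim/ltn_ind: d f => d IHd f Af hf.
have Ag : inA P (strip Psi 1 d f) by exact: inA_strip.
have hg : homogA d.+1 (strip Psi 1 d f) by exact: homogA_strip.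
split=> //; last exact: counit_homog hg.
(* The exponents 2, ..., i + 1 already lead into W, where [Psi] is 2, so the remaining factor
   [Psi - 2] gives 0. *)
have kill i t : (i < d)%N -> P t -> deg t = i.+1 -> strip Psi 0 i.+1 << t >> = 0.
  move=> lt_id Pt dt; rewrite stripS_bottom expr1.
  have [|| _ prim _] := IHd i lt_id << t >>; try exact: supportedU.
  by rewrite Psi_primitive // subrr.
have supp_f t : t \in msupp f -> P t && (t != one).
  by move=> tf; rewrite (Af t tf) /=; apply: contra_eq_neq (hf t tf) => ->.
(* Every term becomes an image under [strip Psi2 1 d]; since [Psi] fixes 1, the outer terms agree
   and only the reduced coproduct of [f] is left to kill. *)
rewrite /primitive -strip_tens1 -strip_1tens.
have -> : Delta_a (strip Psi 1 d f) = strip Psi2 1 d (Delta_a f).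
  exact: (strip_morph (L := lift delta) (T' := Psi2) _ _ _ lift_PsiT_delta).
rewrite (Delta_a_reduced supp_f).
rewrite [LHS]linearD [X in X + _]linearD -[RHS]addr0; congr (_ + _).
rewrite [LHS](raddf_lift (strip Psi2 1 d)) -[RHS](lift0 _ f); apply: eq_lift => t tf.
rewrite linear_sum big1_seq //= => -[a b] /andP[/andP[/= a_n1 b_n1] ab].
have /andP[/= Pa Pb] := mons_split (Af t tf) ab.
have /= := splitT_deg ab; rewrite (hf t tf).
move: a_n1 b_n1; rewrite -(mons_deg_eq0 Pa) -(mons_deg_eq0 Pb) -!lt0n.
case da: (deg a) => [|i] // _; case db: (deg b) => [|j] // _ [def_d].
rewrite -tensUU -def_d -[(i + _)%N]/((i.+1 + j.+1).-1).
apply: strip_tens; apply: kill => //.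
  by rewrite -def_d addnS ltnS leq_addr.
by rewrite -def_d addnS ltnS leq_addl.
Qed.

End Doubling.

(** * The projection pi onto W *)

Section Projection.
Variables (K : fieldType) (X : countType) (binary : bool).
Hypothesis charK : [pchar K] =i pred0.
Local Notation mtree := (mtree X).
Local Notation one := (one X).
Local Notation A := {malg K[mtree]}.
Local Notation P := (@mons X binary).
Local Notation Psi := (lift (@PsiT K X)).

Lemma inW0 : inW P (0 : A).
Proof.
split; [exact: supported0 | | exact: mcoeff0].
by rewrite /primitive /Delta_a tens0l !linear0 addr0.
Qed.

Lemma inW_lin (f g : A) k : inW P f -> inW P g -> inW P (f + k *: g).
Proof.
case=> Af pf cf [Ag pg cg]; split.
- by apply: supportedD => //; apply: supportedZ.
- rewrite /primitive /Delta_a lift_add lift_scale.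
  apply: etrans (congr2 (fun u v => u + k *: v) pf pg) _.
  by rewrite tensDl tensZl tensDr tensZr scalerDr addrACA.
- by rewrite /counitA mcoeffD mcoeffZ -/(counitA f) -/(counitA g) cf cg mulr0 addr0.
Qed.

Lemma inWZ (f : A) k : inW P f -> inW P (k *: f).
Proof. by move=> Wf; rewrite -[_ *: _]add0r; apply: inW_lin => //; apply: inW0. Qed.

(** The scalar by which [strip T 1 n] acts on an eigenvector of [T] for the eigenvalue 2. *)
Definition stripc n : K := \prod_(i < n) (2%:R - 2%:R ^+ (1 + i.+1)).

Lemma stripcS n : stripc n.+1 = stripc n * (2%:R - 2%:R ^+ (1 + n.+1)).
Proof. exact: big_ord_recr. Qed.

Lemma stripc_neq0 n : stripc n != 0.
Proof.
apply/prodf_neq0 => i _.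
have lt2 : (2 < 2 ^ (1 + i.+1))%N by rewrite (@ltn_exp2l 2 1).
rewrite -oppr_eq0 opprB -natrX -natrB; last exact: ltnW.
by have /pcharf0P -> := charK; rewrite subn_eq0 -ltnNge.
Qed.

(* On the elements of A of degrees in [1, n + 1], where Psi is diagonalisable
   with eigenvalues 2, ..., 2^(n+1): the projection onto the eigenspace of 2. *)
Definition piN n (f : A) : A := (stripc n)^-1 *: strip Psi 1 n f.

Definition piT (t : mtree) : A :=
  if t == one then 0 else piN (deg t).-1 << t >>.

Lemma piN_primitive n f : primitive f -> piN n f = f.
Proof.
move=> /Psi_primitive Psif.
by rewrite /piN (strip_eigen _ _ Psif) scalerA mulVf ?scale1r ?stripc_neq0.
Qed.

Lemma mons_basis t : P t -> inA P (<< t >> : A).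
Proof. by move=> Pt; apply: supportedU. Qed.

Lemma piT_inW t : P t -> inW P (piT t).
Proof.
rewrite /piT; case: ifPn => [_ _|t_n1 Pt]; first exact: inW0.
apply: inWZ; apply: strip_inW; first exact: mons_basis.
by apply: supportedU; rewrite prednK // lt0n (mons_deg_eq0 Pt).
Qed.

Lemma piT_homog t : homogA (deg t) (piT t).
Proof.
rewrite /piT; case: ifPn => _; first exact: supported0.
by apply: supportedZ; apply: homogA_strip; apply: supportedU.
Qed.

(** Once the value lies in W, a further factor [Psi - 2^(k+2)] acts as the scalar 2 - 2^(k+2), which
    the normalisation [stripc] divides out. So [n] may be any large enough bound, the same for all
    monomials. *)
Lemma piN_piT n t : P t -> t != one -> (deg t <= n.+1)%N ->
  piN n << t >> = piT t.
Proof.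
move=> Pt t_n1; have d_gt0 : (0 < deg t)%N by rewrite lt0n (mons_deg_eq0 Pt).
rewrite -{1}(prednK d_gt0) ltnS => /subnKC <-.
have [_ prim _] := piT_inW Pt.
elim: (n - _)%N => [|m IHm]; first by rewrite addn0 /piT (negbTE t_n1).
move: IHm; set k := (_ + m)%N => IHm; rewrite addnS -/k.
have strip_k : strip Psi 1 k << t >> = stripc k *: piT t.
  by rewrite -IHm scalerA mulfV ?scale1r ?stripc_neq0.
have -> : piN k.+1 << t >> = (stripc k.+1)^-1 *: (stripc k.+1 *: piT t).
  congr (_ *: _); rewrite stripS_top /= strip_k lift_scale (Psi_primitive prim).
  by rewrite !scalerA -scalerBl stripcS mulrBr [_ ^+ _ * _]mulrC.
by rewrite scalerA mulVf ?scale1r ?stripc_neq0.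
Qed.

(** [f] need not be homogeneous: one [piN n], with [n] bounding all degrees, agrees with pi on every
    monomial of [f] and fixes [f]. *)
Lemma pi_primitive (f : A) : inW P f -> lift piT f = f.
Proof.
case=> Af prim f0; pose n := \max_(t <- msupp f) deg t.
rewrite -[RHS](piN_primitive n prim) /piN (linear_lift (strip Psi 1 n)) -liftZ.
apply: eq_lift => t tf; rewrite -(@piN_piT n t) ?Af //.
  by apply: contraTneq tf => ->; rewrite -mcoeff_neq0 -/(counitA f) f0 eqxx.
by apply: leqW; apply: leq_bigmax_seq.
Qed.

End Projection.

(** * The tensor coalgebra and the map to symmetric tensors *)

Section TensorCoalgebra.
Variables (K : fieldType) (X : countType).
Local Notation mtree := (mtree X).
Local Notation one := (one X).
Local Notation A := {malg K[mtree]}.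
Local Notation TA := {malg K[seq mtree]}.
Local Notation TTA := {malg K[(seq mtree * seq mtree)%type]}.

Definition consm (w : A) (c : TA) : TA :=
  lift (fun a => lift (fun s => << a :: s >>) c) w.

Lemma expand_cons w (ws : seq A) : expand (w :: ws) = consm w (expand ws).
Proof. by []. Qed.

Fact consm_is_linear w : linear (consm w).
Proof.
move=> k c d; rewrite /consm -liftZ -liftD; apply: eq_lift => a _.
by rewrite lift_add lift_scale.
Qed.

HB.instance Definition _ w :=
  GRing.isLinear.Build K TA TA *:%R (consm w) (consm_is_linear w).

Lemma consmD w c d : consm w (c + d) = consm w c + consm w d.
Proof. exact: (linearD (consm w)). Qed.

Lemma consmZ w k c : consm w (k *: c) = k *: consm w c.
Proof. by rewrite linearZ. Qed.

Lemma consm0 w : consm w 0 = 0.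
Proof. exact: (linear0 (consm w)). Qed.

Lemma consm_sum w (I : Type) (r : seq I) (Q : pred I) (F : I -> TA) :
  consm w (\sum_(i <- r | Q i) F i) = \sum_(i <- r | Q i) consm w (F i).
Proof. exact: (linear_sum (consm w)). Qed.

Lemma consm0l c : consm 0 c = 0.
Proof. exact: (linear0 (lift _)). Qed.

Lemma consm_lift (S : choiceType) w (F : S -> TA) f :
  consm w (lift F f) = lift (fun s => consm w (F s)) f.
Proof. exact: (raddf_lift (consm w)). Qed.

Lemma consm_liftl (S : choiceType) (F : S -> A) f c :
  consm (lift F f) c = lift (fun s => consm (F s) c) f.
Proof. exact: lift_lift. Qed.

Lemma mcoeff_consm w c x s : (consm w c)@_(x :: s) = w@_x * c@_s.
Proof.
rewrite mcoeff_lift [w in RHS]monalgE raddf_sum mulr_suml; apply: eq_bigr => a _ /=.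
rewrite mcoeff_lift mcoeffU; have [->|ax] := eqVneq a x.
  congr (_ * _); rewrite [c in RHS]monalgE raddf_sum; apply: eq_bigr => b _ /=.
  by rewrite !mcoeffU eqseq_cons eqxx mulrnAr mulr1.
rewrite mulr0n mul0r big1 ?mulr0 // => b _.
by rewrite mcoeffU eqseq_cons (negbTE ax) mulr0.
Qed.

Lemma mcoeff_consm_nil w c : (consm w c)@_[::] = 0.
Proof.
rewrite mcoeff_lift big1 // => a _; rewrite mcoeff_lift big1 ?mulr0 // => b _.
by rewrite mcoeffU mulr0.
Qed.

Lemma consm_supported (Q : seq mtree -> Prop) w c :
  (forall x s, x \in msupp w -> s \in msupp c -> Q (x :: s)) ->
  supported Q (consm w c).
Proof.
move=> Qxs; apply: supported_lift => x xw; apply: supported_lift => s sc.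
by apply: supportedU; apply: Qxs.
Qed.

Lemma tcompE n (c : TA) :
  tcomp n c = lift (fun u => if size u == n then << u >> else 0) c.
Proof.
rewrite /tcomp big_mkcond liftE; apply: eq_bigr => u _.
by case: ifP => _; rewrite ?scaler0 // malgUZ.
Qed.

Lemma tcomp_size m n (c : TA) : supported (fun u => size u = m) c ->
  tcomp n c = if m == n then c else 0.
Proof.
move=> sz; rewrite tcompE; case: eqP => [mn|/eqP/negbTE mn].
  by rewrite -[RHS]lift_id; apply: eq_lift => u /sz ->; rewrite mn eqxx.
by rewrite -[RHS](lift0 _ c); apply: eq_lift => u /sz ->; rewrite mn.
Qed.

Lemma tcomp_sum n (I : Type) (r : seq I) (Q : pred I) (F : I -> TA) :
  tcomp n (\sum_(i <- r | Q i) F i) = \sum_(i <- r | Q i) tcomp n (F i).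
Proof.
by rewrite tcompE lift_big_sum; apply: eq_bigr => i _; rewrite tcompE.
Qed.

Lemma tcompD n c d : tcomp n (c + d) = tcomp n c + tcomp n d :> TA.
Proof. by rewrite !tcompE lift_add. Qed.

Lemma tcompZ n k c : tcomp n (k *: c) = k *: tcomp n c :> TA.
Proof. by rewrite !tcompE lift_scale. Qed.

Lemma mcoeff_tcomp n (c : TA) u : (tcomp n c)@_u = if size u == n then c@_u else 0.
Proof.
rewrite [c in RHS]monalgE tcompE mcoeff_lift raddf_sum /=.
case: (size u =P n) => [<-|neq].
  apply: eq_bigr => v _; rewrite mcoeffU; have [->|vu] := eqVneq v u.
    by rewrite eqxx mcoeffUU mulr1.
  by case: ifP => _; rewrite ?mcoeffU ?(negbTE vu) ?mcoeff0 mulr0.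
rewrite big1 // => v _; case: eqP => [nv|]; last by rewrite mcoeff0 mulr0.
by rewrite mcoeffU; case: eqP => [vu|]; rewrite ?mulr0 //; case: neq; rewrite -vu.
Qed.

Lemma symmetricD (c d : TA) k : symmetric c -> symmetric d -> symmetric (c + k *: d).
Proof.
by move=> sc sd u v uv; rewrite !mcoeffD !mcoeffZ (sc _ _ uv) (sd _ _ uv).
Qed.

Lemma symmetric_lift (S : choiceType) (F : S -> TA) f :
  (forall s, s \in msupp f -> symmetric (F s)) -> symmetric (lift F f).
Proof.
move=> sF u v uv; rewrite !mcoeff_lift; apply: eq_big_seq => s sf.
by rewrite (sF s sf _ _ uv).
Qed.

Lemma symmetric_tcomp n (c : TA) : symmetric c -> symmetric (tcomp n c).
Proof.
by move=> sc u v uv; rewrite !mcoeff_tcomp (perm_size uv) (sc _ _ uv).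
Qed.

Definition dec (u : seq mtree) : TTA :=
  \sum_(i < (size u).+1) << (take i u, drop i u) >>.

Lemma dec_cons a s : dec (a :: s) =
  << ([::], a :: s) >> + lift (fun p => << (a :: p.1, p.2) >>) (dec s).
Proof.
rewrite /dec big_ord_recl take0 drop0; congr (_ + _).
by rewrite lift_big_sum; apply: eq_bigr => i _; rewrite liftU.
Qed.

Definition consl (w : A) (z : TTA) : TTA :=
  lift (fun p => tens (consm w << p.1 >>) << p.2 >>) z.

Lemma consl_tens w c d : consl w (tens c d) = tens (consm w c) d.
Proof.
rewrite /consl (tensmap_tens (fun s => consm w << s >>) (fun s => << s >>)).
by rewrite -consm_lift !lift_id.
Qed.

Lemma consl0l z : consl 0 z = 0.
Proof.
rewrite /consl -[RHS](lift0 _ z); apply: eq_lift => p _.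
by rewrite consm0l tens0l.
Qed.

(** The cut falls either before the first factor [w] or after it, inside [c]. *)
Lemma deltaDec_consm w c : lift dec (consm w c) =
  tens << [::] >> (consm w c) + consl w (lift dec c).
Proof.
have E1 : tens << [::] >> (consm w c) =
    lift (fun a => lift (fun s => << ([::], a :: s) >>) c) w :> TTA.
  rewrite tensUl lift_lift; apply: eq_lift => a _.
  by rewrite lift_lift; apply: eq_lift => s _; rewrite liftU.
have E2 : consl w (lift dec c) =
  lift (fun a => lift (fun s => lift (fun p => << (a :: p.1, p.2) >>) (dec s)) c) w.
  rewrite /consl lift_lift [RHS]exchange_lift; apply: eq_lift => s _.
  rewrite [RHS]exchange_lift; apply: eq_lift => p _.
  rewrite tensUr lift_lift; apply: eq_lift => a _.
  by rewrite liftU liftU.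
apply: etrans (esym (congr2 +%R E1 E2)).
rewrite lift_lift -liftD; apply: eq_lift => a _.
rewrite lift_lift -liftD; apply: eq_lift => s _.
by rewrite liftU dec_cons.
Qed.

Variable P : pred mtree.

Lemma inTW_lin n (c d : TA) k :
  inTW P n c -> inTW P n d -> inTW P n (c + k *: d).
Proof.
move=> Wc; elim=> [|e l ws sz Wws _ IH]; first by rewrite scaler0 addr0.
by rewrite scalerDr addrA scalerA; apply: inTWadd.
Qed.

Lemma inTW_consm n w (c : TA) :
  inW P w -> inTW P n c -> inTW P n.+1 (consm w c).
Proof.
move=> Ww; elim=> [|e l ws sz Wws _ IH]; first by rewrite consm0; apply: inTW0.
rewrite consmD consmZ -expand_cons; apply: inTWadd => //=; first by rewrite sz.
by move=> v; rewrite in_cons => /predU1P[->|/Wws].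
Qed.

Lemma inTW_sum n (I : eqType) (r : seq I) (F : I -> TA) :
  (forall i, i \in r -> inTW P n (F i)) -> inTW P n (\sum_(i <- r) F i).
Proof.
move=> WF; rewrite big_seq; apply: big_ind => //; first exact: inTW0.
by move=> x y Wx Wy; rewrite -[y]scale1r; apply: inTW_lin.
Qed.

Lemma inTW_lift n (S : choiceType) (F : S -> TA) f :
  (forall s, s \in msupp f -> inTW P n (F s)) -> inTW P n (lift F f).
Proof.
move=> WF; rewrite liftE; apply: inTW_sum => s /WF Ws.
by rewrite -[_ *: _]add0r; apply: inTW_lin => //; apply: inTW0.
Qed.

Lemma inTW_size n (c : TA) : inTW P n c -> supported (fun u => size u = n) c.
Proof.
elim=> [|d k ws sz _ _ IH]; first exact: supported0.
apply: supportedD => //; apply: supportedZ => {IH}.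
rewrite -{}sz; elim: ws => [|w ws IHws]; first exact: supportedU.
by apply: consm_supported => x s _ /IHws /= ->.
Qed.

End TensorCoalgebra.

(** * The coalgebra morphism phi *)

Section CoalgebraMap.
Variables (K : fieldType) (X : countType) (binary : bool).
Hypothesis charK : [pchar K] =i pred0.
Local Notation mtree := (mtree X).
Local Notation one := (one X).
Local Notation A := {malg K[mtree]}.
Local Notation TA := {malg K[seq mtree]}.
Local Notation TTA := {malg K[(seq mtree * seq mtree)%type]}.
Local Notation P := (@mons X binary).
Local Notation pi := (@piT K X).
Local Notation dec := (@dec K X).
Local Notation delta := (@deltaT K X).

Definition unitT (t : mtree) : TA := if t == one then << [::] >> else 0.

(* The composite of the n-fold iterated co-addition with the n-th tensor
   power of the projection pi onto W. *)
Fixpoint compT (n : nat) (t : mtree) : TA :=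
  if n is m.+1 then \sum_(p <- splitT t) consm (pi p.1) (compT m p.2)
  else unitT t.

Definition phiT (t : mtree) : TA := \sum_(n < (deg t).+1) compT n t.

Lemma pi_one : pi one = 0.
Proof. by rewrite /piT eqxx. Qed.

Lemma split_degP t p : P t -> p \in splitT t ->
  (p.1 == one) || (deg p.2 < deg t)%N.
Proof.
move=> Pt pt; have /andP[Pp _] := mons_split Pt pt.
rewrite -(mons_deg_eq0 Pp) -(splitT_deg pt) -[X in (X < _)%N]add0n ltn_add2r.
by case: (deg p.1).
Qed.

Lemma compT_size n t : supported (fun u => size u = n) (compT n t).
Proof.
elim: n t => [|n IHn] t /=.
  by rewrite /unitT; case: ifP => _; [apply: supportedU | apply: supported0].
apply: supported_sum => p _; apply: consm_supported => x s _ /IHn /= ->.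
by [].
Qed.

(** Conilpotency: pi kills [one], so each tensor factor of a nonzero term uses up a leaf. Truncating
    [phiT] at [deg t] therefore loses nothing. *)
Lemma compT_gt n t : P t -> (deg t < n)%N -> compT n t = 0.
Proof.
elim: n t => [//|n IHn] t Pt le_tn; rewrite /= big1_seq //= => p pt.
have /predU1P[->|lt_p2] := split_degP Pt pt; first by rewrite pi_one consm0l.
have /andP[_ Pp2] := mons_split Pt pt.
by rewrite IHn ?consm0 // (leq_trans lt_p2).
Qed.

Lemma phiT_sum N t : P t -> (deg t < N)%N -> phiT t = \sum_(n < N) compT n t.
Proof.
move=> Pt lt_N; rewrite /phiT (big_ord_widen N (fun n => compT n t)) //.
rewrite [RHS](bigID (fun n : 'I_N => (n < (deg t).+1)%N)) /= [X in _ + X]big1 ?addr0 //.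
by move=> n; rewrite -leqNgt => /(compT_gt Pt).
Qed.

(** The equation phi = counit + (pi (x) phi) o Delta_a, which exposes the first tensor factor as
    [deltaDec_consm] requires. *)
Lemma phiT_rec t : P t ->
  phiT t = unitT t + \sum_(p <- splitT t) consm (pi p.1) (phiT p.2).
Proof.
(* One summand more than in the definition: after removal of n = 0, [(deg t).+1] summands remain,
   enough for every [p.2]. *)
move=> Pt; rewrite (@phiT_sum (deg t).+2) // big_ord_recl; congr (_ + _).
rewrite exchange_big; apply: eq_big_seq => p pt /=.
have /andP[_ Pp2] := mons_split Pt pt.
rewrite -consm_sum; congr (consm _ _); apply/esym/phiT_sum => //.
by rewrite ltnS -(splitT_deg pt) leq_addl.
Qed.

Lemma tcomp_phiT n t : P t -> tcomp n (phiT t) = compT n t.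
Proof.
move=> Pt; pose N := (maxn n (deg t)).+1.
have lt_nN : (n < N)%N by rewrite ltnS leq_maxl.
rewrite (@phiT_sum N) ?ltnS ?leq_maxr // tcomp_sum (bigD1 (Ordinal lt_nN)) //=.
rewrite (tcomp_size _ (@compT_size _ _)) eqxx big1 ?addr0 // => i ne_i.
rewrite (tcomp_size _ (@compT_size _ _)) ifN //.
Qed.

Lemma compT_inTW n t : P t -> inTW P n (compT n t).
Proof.
elim: n t => [|n IHn] t Pt /=.
  rewrite /unitT; case: ifP => _; last exact: inTW0.
  rewrite -[<< _ >>]scale1r -[_ *: _]add0r -[<< _ >>]/(expand [::]).
  by apply: inTWadd => //; apply: inTW0.
apply: inTW_sum => p pt; have /andP[Pp1 Pp2] := mons_split Pt pt.
by apply: inTW_consm (IHn _ Pp2); apply: piT_inW.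
Qed.

(** The first two letters come from the first two factors of a threefold coproduct, which
    cocommutativity exchanges. *)
Lemma compT_swap n t x y s :
  (compT n t)@_(x :: y :: s) = (compT n t)@_(y :: x :: s).
Proof.
case: n => [|[|n]] /=.
- by rewrite /unitT; case: ifP => _; rewrite ?mcoeff0 // !mcoeffU.
- rewrite !raddf_sum; apply: eq_bigr => p _ /=; rewrite !mcoeff_consm.
  by rewrite /unitT; case: ifP => _; rewrite ?mcoeff0 ?mcoeffU !mulr0.
pose G x y a b c := (pi a)@_x * (pi b)@_y * (compT n c)@_s.
have E z w : (compT n.+2 t)@_[:: z, w & s] =
    \sum_(p <- splitT t) \sum_(q <- splitT p.2) G z w p.1 q.1 q.2.
  rewrite raddf_sum; apply: eq_bigr => p _ /=; rewrite mcoeff_consm.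
  rewrite raddf_sum mulr_sumr; apply: eq_bigr => q _ /=.
  by rewrite mcoeff_consm mulrA.
rewrite -[LHS]/((compT n.+2 t)@_[:: x, y & s]) -[RHS]/((compT n.+2 t)@_[:: y, x & s]).
rewrite !E !big_splitT_assoc; apply: eq_bigr => p _.
rewrite (big_splitT_sym (fun a b => G x y a b p.2)); apply: eq_bigr => q _.
exact: (congr1 (fun k => k * (compT n p.2)@_s) (mulrC (pi q.2)@_x (pi q.1)@_y)).
Qed.

(** Permutations of the tail and the exchange of the first two letters suffice: the head of [v] is
    brought to second place in [u], then swapped to the front. *)
Lemma compT_sym n t : symmetric (compT n t).
Proof.
elim: n t => [|n IHn] t u v uv.
  rewrite /= /unitT; case: ifP => _; rewrite ?mcoeff0 // !mcoeffU.
  by move: (perm_size uv); case: (u); case: (v).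
have cons_perm x (u' v' : seq mtree) : perm_eq u' v' ->
    (compT n.+1 t)@_(x :: u') = (compT n.+1 t)@_(x :: v').
  move=> uv'; rewrite /= !raddf_sum; apply: eq_bigr => p _ /=.
  by rewrite !mcoeff_consm (IHn _ _ _ uv').
case: u v uv => [|x u] [|y v] uv //; try by move: (perm_size uv).
have [eq_xy|ne_xy] := eqVneq x y.
  by move: uv; rewrite eq_xy perm_cons; apply: cons_perm.
have yu : y \in u.
  by move: (mem_head y v); rewrite -(perm_mem uv) in_cons eq_sym (negbTE ne_xy).
have pu := perm_to_rem yu; rewrite (cons_perm _ _ _ pu) compT_swap.
apply: cons_perm; rewrite -(perm_cons y); apply: perm_trans uv.
by rewrite -[y :: _]/([:: y] ++ [:: x] ++ rem y u) perm_catCA perm_cons perm_sym.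
Qed.

Lemma compT_homog n t : P t -> homogT (deg t) (compT n t).
Proof.
elim: n t => [|n IHn] t Pt /=.
  rewrite /unitT; case: eqP => [->|_]; [exact: supportedU | exact: supported0].
apply: supported_sum => p pt; have /andP[_ Pp2] := mons_split Pt pt.
apply: consm_supported => x s /piT_homog dx /(IHn _ Pp2) ds /=.
by rewrite dx ds (splitT_deg pt).
Qed.

(** Cuts before the first factor give the term with [phiT p.1] replaced by its unit part. For the
    others the induction hypothesis is applied to [p.2], of smaller degree unless [p.1] is [one],
    which pi kills; coassociativity then rebuilds the rest of [phiT p.1] by [phiT_rec]. *)
Lemma deltaDec_phiT t : P t -> lift dec (phiT t) =
  \sum_(p <- splitT t) tens (phiT p.1) (phiT p.2).
Proof.
have [n] := ubnP (deg t); elim: n t => // n IHn t; rewrite ltnS => le_tn Pt.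
have dec_unit u : lift dec (unitT u) = tens << [::] >> (unitT u).
  rewrite /unitT; case: ifP => _; last by rewrite linear0 [RHS]linear0.
  by rewrite liftU tensUU /dec big_ord_recl big_ord0 addr0.
have counit : \sum_(p <- splitT t) tens (unitT p.1) (phiT p.2) =
    tens << [::] >> (phiT t).
  rewrite -(big_splitT_counit (fun u => tens << [::] >> (phiT u)) Pt).
  rewrite [RHS]big_mkcond; apply: eq_bigr => p _; rewrite /unitT.
  by case: ifP => _ //; rewrite tens0l.
pose G a b c := tens (consm (pi a) (phiT b)) (phiT c).
have assoc : \sum_(p <- splitT t) consl (pi p.1) (lift dec (phiT p.2)) =
    \sum_(p <- splitT t) \sum_(q <- splitT p.2) G p.1 q.1 q.2.
  apply: eq_big_seq => p pt; have /andP[_ Pp2] := mons_split Pt pt.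
  have /predU1P[p1|lt_p2] := split_degP Pt pt.
    rewrite p1 /G pi_one consl0l big1 // => q _.
    by rewrite consm0l tens0l.
  rewrite (IHn _ (leq_trans lt_p2 le_tn) Pp2) /consl lift_big_sum.
  by apply: eq_bigr => q _; apply: consl_tens.
rewrite {1}(phiT_rec Pt) lift_add lift_big_sum dec_unit.
under eq_bigr => p _ do rewrite deltaDec_consm.
rewrite big_split /= assoc big_splitT_assoc addrA.
have -> : tens << [::] >> (unitT t) +
    \sum_(p <- splitT t) tens << [::] >> (consm (pi p.1) (phiT p.2)) =
    tens << [::] >> (phiT t) :> TTA.
  by rewrite [in RHS](phiT_rec Pt) tensDr; congr (_ + _); rewrite linear_sum.
rewrite -counit -big_split; apply: eq_big_seq => p pt /=.
have /andP[Pp1 _] := mons_split Pt pt.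
by rewrite (phiT_rec Pp1) tensDl tens_suml.
Qed.

Lemma mcoeff_phiT_nil t : P t -> (phiT t)@_[::] = (t == one)%:R.
Proof.
move=> Pt; rewrite (phiT_rec Pt) mcoeffD raddf_sum big1 ?addr0 => [|p _].
  by rewrite /unitT; case: ifP => _; rewrite ?mcoeffUU ?mcoeff0.
exact: mcoeff_consm_nil.
Qed.

Definition phi : {linear A -> TA} := lift phiT.

Lemma phi_inC f : inA P f -> inC P (phi f).
Proof.
move=> Af; split=> [|n].
  apply: symmetric_lift => t tf; rewrite /phiT => u v uv; rewrite !raddf_sum.
  by apply: eq_bigr => n _; apply: compT_sym.
rewrite tcompE lift_lift; apply: inTW_lift => t tf.
by rewrite -tcompE tcomp_phiT; [apply: compT_inTW|]; apply: Af.
Qed.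

Lemma phi_homog d f : inA P f -> homogA d f -> homogT d (phi f).
Proof.
move=> Af hf; apply: supported_lift => t tf; apply: supported_sum => n _.
by rewrite -(hf t tf); apply: compT_homog; apply: Af.
Qed.

Lemma phi_counit f : inA P f -> counitT (phi f) = counitA f.
Proof.
move=> Af; rewrite /counitT mcoeff_lift /counitA [f in RHS]monalgE raddf_sum.
apply: eq_big_seq => t tf; rewrite mcoeff_phiT_nil ?Af //=.
by rewrite mcoeffU mulr_natr.
Qed.

Lemma phi_delta f : inA P f -> deltaDec (phi f) = tensmap phi phi (Delta_a f).
Proof.
move=> Af; rewrite /deltaDec /tensmap /Delta_a !lift_lift.
apply: eq_lift => t tf; rewrite lift_deltaT.
apply: etrans (deltaDec_phiT (Af t tf)) _; apply: eq_bigr => p _.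
rewrite -[phi << p.1 >>]/(lift phiT << p.1 >>).
by rewrite -[phi << p.2 >>]/(lift phiT << p.2 >>) !liftU.
Qed.

Lemma tcomp_phi n f : inA P f -> tcomp n (phi f) = lift (compT n) f.
Proof.
move=> Af; rewrite tcompE lift_lift; apply: eq_lift => t /Af Pt.
by rewrite -tcompE tcomp_phiT.
Qed.

End CoalgebraMap.

(** * Injectivity *)

Section Injectivity.
Variable K : fieldType.

(** Injectivity is used one factor at a time: the coefficient at [v] of the second image leaves a
    combination of first components killed by [F], and its coefficients at [a] in turn give one of
    second components. [slice_inj] serves both passes, [pr] being [fst], then [snd]. *)
Lemma tensor_square_inj (S T : choiceType) (Q : S -> Prop) (F : S -> {malg K[T]}) :
  (forall g, supported Q g -> lift F g = 0 -> g = 0) ->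
  forall z, supported (fun p => Q p.1 /\ Q p.2) z ->
  lift (fun p => tens (F p.1) (F p.2)) z = 0 -> z = 0.
Proof.
move=> injF z Qz Fz0.
have slice_inj (r : seq (S * S)) (k : S * S -> K) (pr : S * S -> S) :
    (forall p, p \in r -> Q (pr p)) ->
    (forall u, \sum_(p <- r) k p * (F (pr p))@_u = 0) ->
    forall a, \sum_(p <- r) k p * (pr p == a)%:R = 0.
  move=> Qr k0 a; have g0 : \sum_(p <- r) k p *: << pr p >> = 0 :> {malg K[S]}.
    apply: injF.
      by apply: supported_sum => p /Qr Qp; apply: supportedZ; apply: supportedU.
    apply/malgP => u; rewrite lift_big_sum raddf_sum mcoeff0 -[RHS](k0 u).
    by apply: eq_bigr => p _ /=; rewrite lift_scale mcoeffZ liftU.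
  have ga := congr1 (mcoeff a) g0; rewrite mcoeff0 in ga.
  apply: etrans ga; rewrite raddf_sum.
  by apply: eq_bigr => p _ /=; rewrite mcoeffZ mcoeffU.
apply/malgP => -[a b]; rewrite mcoeff0.
have coef_b v : \sum_(p <- msupp z) z@_p * (p.1 == a)%:R * (F p.2)@_v = 0.
  rewrite -[RHS](slice_inj (msupp z) (fun p => z@_p * (F p.2)@_v) fst _ _ a).
  - by apply: eq_bigr => p _; rewrite mulrAC.
  - by move=> p /Qz[].
  move=> u; have Fz_uv := congr1 (mcoeff (u, v)) Fz0.
  rewrite mcoeff0 mcoeff_lift in Fz_uv; apply: etrans Fz_uv.
  by apply: eq_bigr => p _; rewrite mcoeff_tens mulrAC mulrA.
rewrite -[RHS](slice_inj _ _ snd _ coef_b b); last by move=> p /Qz[].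
rewrite [z in LHS]monalgE raddf_sum; apply: eq_bigr => -[x y] _ /=.
by rewrite mcoeffU xpair_eqE -mulrA -natrM mulnb mulr_natr.
Qed.

Variables (X : countType) (binary : bool).
Hypothesis charK : [pchar K] =i pred0.
Local Notation mtree := (mtree X).
Local Notation one := (one X).
Local Notation A := {malg K[mtree]}.
Local Notation P := (@mons X binary).
Local Notation pi := (@piT K X).
Local Notation phi := (@phi K X).

(** In tensor degree 1 the map phi is pi, by the counit axiom; this makes phi injective on W. *)
Lemma mcoeff_phi1 f x : inA P f -> (phi f)@_[:: x] = (lift pi f)@_x.
Proof.
move=> Af; transitivity ((tcomp 1 (phi f))@_[:: x]); first by rewrite mcoeff_tcomp.
rewrite (tcomp_phi 1 Af) !mcoeff_lift; apply: eq_big_seq => t /Af Pt.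
congr (_ * _); rewrite -(big_splitT_counit (fun u => (pi u)@_x) Pt) big_mkcond.
rewrite (big_splitT_sym (fun a b => if a == one then (pi b)@_x else 0)).
rewrite raddf_sum; apply: eq_bigr => p _ /=; rewrite mcoeff_consm /unitT.
by case: ifP => _; rewrite ?mcoeffUU ?mulr1 // mcoeff0 mulr0.
Qed.

(** Induction on a strict bound for the degrees, as [f] need not be homogeneous. If phi kills [g],
    then phi (x) phi kills its reduced coproduct, whose components have smaller degree, so it
    vanishes by induction; thus [g] is in W and equals its image under pi, which is 0. *)
Lemma phi_inj0 f : inA P f -> phi f = 0 -> f = 0.
Proof.
pose small d t := P t /\ (deg t < d)%N.
have phi0_small d : forall g, supported (small d) g -> phi g = 0 -> g = 0.
  elim: d => [|d IHd] g small_g phi_g.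
    apply/malgP => t; rewrite mcoeff0; apply: mcoeff_outdom.
    by apply/negP => /small_g[].
  have Ag : inA P g by move=> t /small_g[].
  have g0 : counitA g = 0.
    by rewrite -(phi_counit Ag) phi_g /counitT mcoeff0.
  have supp_g t : t \in msupp g -> P t && (t != one).
    move=> tg; rewrite (Ag t tg) /=; apply: contraTneq tg => ->.
    by rewrite -mcoeff_neq0 -/(counitA g) g0 eqxx.
  have := Delta_a_reduced supp_g; set red := lift _ g => Delta_g.
  have red0 : red = 0.
    apply: (tensor_square_inj IHd).
      apply: supported_lift => t tg; rewrite -big_filter; apply: supported_sum.
      move=> p; rewrite mem_filter => /andP[/andP[p1 p2] pt].
      have [Pt lt_t] := small_g t tg.
      have /andP[Pp1 Pp2] := mons_split Pt pt.
      apply: supportedU; rewrite /small Pp1 Pp2; move: p1 p2 lt_t.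
      rewrite -(mons_deg_eq0 Pp1) -(mons_deg_eq0 Pp2) -(splitT_deg pt) !ltnS -!lt0n.
      move=> p1 p2 le_d; split; split=> //; apply: leq_trans le_d.
        by rewrite -[X in (X < _)%N]addn0 ltn_add2l.
      by rewrite -[X in (X < _)%N]add0n ltn_add2r.
    pose F (t : mtree) := phi << t >>.
    have FE h : lift F h = phi h by rewrite [RHS]linear_lift.
    pose L := lift (fun p => tens (F p.1) (F p.2)).
    have L_g1 : L (tens g << one >>) = 0.
      by apply: etrans (tensmap_tens F F _ _) _; rewrite FE phi_g tens0l.
    have L_1g : L (tens << one >> g) = 0.
      by apply: etrans (tensmap_tens F F _ _) _; rewrite [lift F g]FE phi_g linear0.
    have L_red : L (Delta_a g) = L red.
      apply: etrans (congr1 L Delta_g) _; apply: etrans (lift_add _ _ _) _.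
      apply: etrans (congr1 (fun y => y + L red) (_ : _ = 0)) (add0r _).
      apply: etrans (lift_add _ _ _) _.
      exact: etrans (congr2 +%R L_g1 L_1g) (addr0 0).
    have L0 : L (Delta_a g) = 0.
      apply: etrans (esym (phi_delta Ag)) _; rewrite phi_g.
      exact: (linear0 (lift _)).
    apply: etrans L0; apply: etrans (esym L_red).
    by apply: eq_lift => p _; rewrite /F /= !liftU.
  have Wg : inW P g by split=> //; rewrite /primitive Delta_g red0 addr0.
  apply/malgP => x; rewrite mcoeff0 -(pi_primitive charK Wg) -(mcoeff_phi1 _ Ag).
  by rewrite phi_g mcoeff0.
move=> Af phi_f; pose d := \max_(t <- msupp f) deg t.
apply: (phi0_small d.+1) => // t tf; split; first exact: Af.
by rewrite ltnS; apply: leq_bigmax_seq.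
Qed.

End Injectivity.

(** * Surjectivity *)

Section Shuffles.
Variables (K : fieldType) (X : countType).
Local Notation mtree := (mtree X).
Local Notation one := (one X).
Local Notation TA := {malg K[seq mtree]}.

Definition del (T : Type) (i : nat) (u : seq T) := take i u ++ drop i.+1 u.

Lemma del0 (T : Type) w (ws : seq T) : del 0 (w :: ws) = ws.
Proof. by rewrite /del drop1 take0. Qed.

Lemma delS (T : Type) i w (ws : seq T) : del i.+1 (w :: ws) = w :: del i ws.
Proof. by []. Qed.

Lemma size_del (T : Type) i (u : seq T) : (i < size u)%N -> size (del i u) = (size u).-1.
Proof.
move=> lt_i; rewrite size_cat size_takel 1?ltnW // size_drop.
by rewrite subnS -subn1 addnBA ?subn_gt0 // subnKC ?subn1 // ltnW.
Qed.

Lemma perm_del (T : eqType) x0 i (u : seq T) : (i < size u)%N ->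
  perm_eq (nth x0 u i :: del i u) u.
Proof.
move=> lt_i; rewrite -[X in perm_eq _ X](cat_take_drop i u) (drop_nth x0) //.
by rewrite perm_sym -cat1s perm_catCA cat1s.
Qed.

Lemma del_inj (T : eqType) x0 i (u v : seq T) : (i < size u)%N ->
  size u = size v -> nth x0 u i = nth x0 v i -> del i u = del i v -> u = v.
Proof.
move=> lt_iu sz eq_nth /eqP; have lt_iv := lt_iu; rewrite sz in lt_iv.
rewrite eqseq_cat ?size_takel 1?ltnW // => /andP[/eqP eq_t /eqP eq_d].
rewrite -(cat_take_drop i u) -(cat_take_drop i v).
by rewrite (drop_nth x0 lt_iu) (drop_nth x0 lt_iv) eq_nth eq_t eq_d.
Qed.

(* Lehmer codes of the permutations of n letters, and their action on the
   words of length n. *)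
Fixpoint codes (n : nat) : seq (seq nat) :=
  if n is m.+1 then [seq i :: l | i <- iota 0 m.+1, l <- codes m] else [:: [::]].

Fixpoint act (l : seq nat) (u : seq mtree) : seq mtree :=
  if l is i :: l' then nth one u i :: act l' (del i u) else u.

Lemma size_codes n : size (codes n) = n`!.
Proof.
elim: n => // n IHn; rewrite factS -IHn -[n.+1 in RHS](size_iota 0).
exact: size_allpairs.
Qed.

Lemma codesP n l : l \in codes n.+1 ->
  exists i l', [/\ (i < n.+1)%N, l' \in codes n & l = i :: l'].
Proof.
case/(allpairsP (s := iota 0 n.+1)) => -[i l'] [i_n l'n ->].
by exists i, l'; split; rewrite // mem_iota in i_n.
Qed.

Lemma act_perm n l u : l \in codes n -> size u = n -> perm_eq (act l u) u.
Proof.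
elim: n l u => [|n IHn] l u; first by rewrite inE => /eqP->.
case/codesP => i [l' [i_n l'n ->]] sz_u /=.
have lt_iu : (i < size u)%N by rewrite sz_u.
apply: perm_trans (perm_del one lt_iu); rewrite perm_cons; apply: IHn => //.
by rewrite size_del // sz_u.
Qed.

Lemma act_inj n l u v : l \in codes n -> size u = n -> size v = n ->
  act l u = act l v -> u = v.
Proof.
elim: n l u v => [|n IHn] l u v; first by rewrite inE => /eqP->.
case/codesP => i [l' [i_n l'n ->]] sz_u sz_v /= [eq_i eq_d].
have lt_iu : (i < size u)%N by rewrite sz_u.
have lt_iv : (i < size v)%N by rewrite sz_v -sz_u.
apply: (del_inj lt_iu _ eq_i); first by rewrite sz_u.
by apply: IHn eq_d; rewrite // size_del // ?sz_u ?sz_v.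
Qed.

(** By symmetry of [c] the map [g] preserves coefficients, hence maps the finite support into
    itself; being injective there it permutes the support. *)
Lemma lift_perm_symmetric (g : seq mtree -> seq mtree) (c : TA) :
  symmetric c -> (forall u, u \in msupp c -> perm_eq (g u) u) ->
  {in msupp c &, injective g} -> lift (fun u => << g u >>) c = c.
Proof.
move=> sc perm_g inj_g; have cg u : u \in msupp c -> c@_(g u) = c@_u.
  by move=> /perm_g /sc.
rewrite -[RHS]lift_id !liftE.
transitivity (\sum_(v <- map g (msupp c)) c@_v *: << v >>).
  by rewrite big_map; apply: eq_big_seq => u /cg ->.
have uniq_g : uniq (map g (msupp c)) by rewrite map_inj_in_uniq ?fset_uniq.
have sub_g : {subset map g (msupp c) <= msupp c}.
  by move=> _ /mapP[u uc ->]; rewrite -mcoeff_neq0 cg // mcoeff_neq0.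
apply: perm_big; apply: uniq_perm => //; first exact: fset_uniq.
by apply: (uniq_min_size uniq_g sub_g _).2; rewrite size_map.
Qed.

Definition symm (n : nat) (u : seq mtree) : TA := \sum_(l <- codes n) << act l u >>.

Lemma symm_symmetric n (c : TA) : symmetric c ->
  supported (fun u => size u = n) c -> lift (symm n) c = n`!%:R *: c.
Proof.
move=> sc sz_c; rewrite lift_sum -size_codes scaler_nat -iter_addr_0.
rewrite -(count_predT (codes n)) -big_const_seq; apply: eq_big_seq => l l_n.
apply: lift_perm_symmetric => // [u uc|u v uc vc].
  by apply: act_perm l_n _; apply: sz_c.
by apply: act_inj l_n _ _; apply: sz_c.
Qed.

(** Permutations are coded by the choice of a first letter because [compT] follows the same
    recursion on products of primitive elements. *)
Lemma symmS n u : symm n.+1 u =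
  \sum_(0 <= i < n.+1) lift (fun v => << nth one u i :: v >>) (symm n (del i u)).
Proof.
rewrite /symm big_allpairs_dep /index_iota subn0; apply: eq_bigr => i _.
by rewrite lift_big_sum; apply: eq_bigr => l _; rewrite liftU.
Qed.

(** By multilinearity, singling out the i-th letter of the words of a pure tensor singles out its
    i-th factor. *)
Lemma lift_expand_del (S : choiceType) (F : mtree -> seq mtree -> {malg K[S]})
    i (ws : seq {malg K[mtree]}) : (i < size ws)%N ->
  lift (fun u => F (nth one u i) (del i u)) (expand ws) =
  lift (fun a => lift (F a) (expand (del i ws))) (nth 0 ws i).
Proof.
elim: ws i F => [//|w ws IHws] [|i] F lt_i; rewrite expand_cons lift_lift.
  rewrite del0; apply: eq_lift => a _; rewrite lift_lift; apply: eq_lift => s _.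
  by rewrite liftU del0.
rewrite delS expand_cons; transitivity (lift (fun a => lift (fun x =>
    lift (fun r => F x (a :: r)) (expand (del i ws))) (nth 0 ws i)) w).
  apply: eq_lift => a _; rewrite lift_lift -(IHws i (fun x r => F x (a :: r))) //.
  by apply: eq_lift => s _; rewrite liftU delS.
rewrite exchange_lift; apply: eq_lift => x _; rewrite lift_lift.
apply: eq_lift => a _; rewrite lift_lift; apply: eq_lift => r _.
by rewrite liftU.
Qed.

Lemma symm_expand n (ws : seq {malg K[mtree]}) : size ws = n.+1 ->
  lift (symm n.+1) (expand ws) =
  \sum_(0 <= i < n.+1) consm (nth 0 ws i) (lift (symm n) (expand (del i ws))).
Proof.
move=> sz; transitivity (\sum_(0 <= i < n.+1) lift (fun u =>
    lift (fun v => << nth one u i :: v >>) (symm n (del i u))) (expand ws)).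
  by rewrite -lift_sum; apply: eq_lift => u _; apply: symmS.
apply: eq_big_nat => i /andP[_ lt_i].
pose F a r := lift (fun v => << a :: v >>) (symm n r) : TA.
have lt_iws : (i < size ws)%N by rewrite sz.
apply: etrans (lift_expand_del F lt_iws) _; apply: eq_lift => a _.
by rewrite lift_lift.
Qed.

End Shuffles.

(** * Splittings of a word into a subword and its complement *)

Section Splits.
Variable T : eqType.

(** These index the coproduct of a product of primitive elements, each of which goes entirely to the
    left or to the right. *)
Fixpoint splits (ws : seq T) : seq (seq T * seq T) :=
  if ws is w :: ws' then
    [seq (w :: s.1, s.2) | s <- splits ws'] ++ [seq (s.1, w :: s.2) | s <- splits ws']
  else [:: ([::], [::])].

Lemma big_splits_cons (V : nmodType) (Q : pred (seq T * seq T))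
    (H : seq T -> seq T -> V) w ws :
  \sum_(s <- splits (w :: ws) | Q s) H s.1 s.2 =
  \sum_(s <- splits ws | Q (w :: s.1, s.2)) H (w :: s.1) s.2 +
  \sum_(s <- splits ws | Q (s.1, w :: s.2)) H s.1 (w :: s.2).
Proof. by rewrite big_cat !big_map. Qed.

Lemma splits_size ws s : s \in splits ws -> (size s.1 + size s.2)%N = size ws.
Proof.
elim: ws s => [|w ws IHws] s /=; first by rewrite inE => /eqP->.
by rewrite mem_cat => /orP[] /mapP[r /IHws <- ->] /=; rewrite ?addSn ?addnS.
Qed.

Lemma splits_sub ws s : s \in splits ws ->
  {subset s.1 <= ws} /\ {subset s.2 <= ws}.
Proof.
elim: ws s => [|w ws IHws] s /=; first by rewrite inE => /eqP->.
rewrite mem_cat => /orP[] /mapP[r /IHws[s1 s2] ->] /=; split=> x; rewrite !in_cons.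
- by case/predU1P=> [->|/s1->]; rewrite ?eqxx ?orbT.
- by move/s2->; rewrite orbT.
- by move/s1->; rewrite orbT.
- by case/predU1P=> [->|/s2->]; rewrite ?eqxx ?orbT.
Qed.

Lemma big_splits_size0 (V : nmodType) (H : seq T -> seq T -> V) ws :
  \sum_(s <- splits ws | size s.1 == 0%N) H s.1 s.2 = H [::] ws.
Proof.
elim: ws H => [|w ws IHws] H; first by rewrite big_mkcond big_seq1.
by rewrite big_splits_cons big_pred0 //= add0r (IHws (fun a b => H a (w :: b))).
Qed.

Lemma big_splits_size1 (V : nmodType) (H : seq T -> seq T -> V) x0 ws :
  \sum_(s <- splits ws | size s.1 == 1%N) H s.1 s.2 =
  \sum_(0 <= i < size ws) H [:: nth x0 ws i] (del i ws).
Proof.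
elim: ws H => [|w ws IHws] H; first by rewrite big_mkcond big_seq1 big_geq.
rewrite big_splits_cons /= (big_splits_size0 (fun a b => H (w :: a) b)).
by rewrite (IHws (fun a b => H a (w :: b))) big_nat_recl //= del0.
Qed.

End Splits.

(** * Products of primitive elements and preimages of symmetric tensors *)

Section Surjectivity.
Variables (K : fieldType) (X : countType) (binary : bool).
Hypothesis charK : [pchar K] =i pred0.
Local Notation mtree := (mtree X).
Local Notation one := (one X).
Local Notation A := {malg K[mtree]}.
Local Notation TA := {malg K[seq mtree]}.
Local Notation AA := {malg K[(mtree * mtree)%type]}.
Local Notation P := (@mons X binary).
Local Notation pi := (@piT K X).
Local Notation compT := (@compT K X).
Local Notation phi := (@phi K X).
Local Notation delta := (@deltaT K X).

Definition mulA (u v : A) : A := lift (fun a => lift (fun b => << mulT a b >>) v) u.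

Definition mulAA (y z : AA) : AA :=
  lift (fun p => lift (fun q => << (mulT p.1 q.1, mulT p.2 q.2) >>) z) y.

Lemma mulA1 (u : A) : mulA u << one >> = u.
Proof.
rewrite /mulA -[RHS]lift_id; apply: eq_lift => a _.
by rewrite liftU mulT1.
Qed.

Lemma mul1A (v : A) : mulA << one >> v = v.
Proof.
rewrite /mulA liftU -[RHS]lift_id; apply: eq_lift => b _.
by rewrite mul1T.
Qed.

Lemma Delta_mulA u v : Delta_a (mulA u v) = mulAA (Delta_a u) (Delta_a v).
Proof.
rewrite /Delta_a /mulAA /mulA !lift_lift; apply: eq_lift => a _.
rewrite lift_deltaT lift_lift; under [RHS]eq_bigr => p _ do rewrite lift_lift.
rewrite -lift_sum; apply: eq_lift => b _; rewrite liftU deltaT_split.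
transitivity (\sum_(p <- splitT (mulT a b)) << (p.1, p.2) >> : AA).
  by apply: eq_bigr => -[].
rewrite (big_splitT_mul (fun x y => << (x, y) >>)); apply: eq_bigr => p _.
by rewrite lift_deltaT.
Qed.

Lemma mulAA_tens a b c d :
  mulAA (tens a b) (tens c d) = tens (mulA a c) (mulA b d).
Proof.
rewrite /mulAA lift_tens /mulA tens_liftl; apply: eq_lift => x _.
transitivity (lift (fun y => lift (fun x' => lift (fun y' =>
    << (mulT x x', mulT y y') >>) d) c) b).
  by apply: eq_lift => y _; rewrite lift_tens.
rewrite exchange_lift tens_liftl; apply: eq_lift => x' _.
apply: etrans (esym (tensUl _ _)).
apply: etrans (esym (lift_lift _ _ _)); apply: eq_lift => y _.
apply: etrans (esym (lift_lift _ _ _)); apply: eq_lift => y' _.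
by apply: esym; apply: etrans (liftU _ _) _.
Qed.

Lemma mulAADl y y' z : mulAA (y + y') z = mulAA y z + mulAA y' z.
Proof. exact: lift_add. Qed.

Lemma mulAA_sumr y (I : Type) (r : seq I) (F : I -> AA) :
  mulAA y (\sum_(i <- r) F i) = \sum_(i <- r) mulAA y (F i).
Proof.
rewrite /mulAA -lift_sum; apply: eq_lift => p _; exact: lift_big_sum.
Qed.

(** The product is not associative, so the bracketing is fixed to the right. Both factors in
    [Delta_prodA] inherit it, since an omitted element is replaced by the unit. *)
Definition prodA (ws : seq A) : A := foldr mulA << one >> ws.

Lemma Delta_prodA ws : (forall w, w \in ws -> primitive w) ->
  Delta_a (prodA ws) = \sum_(s <- splits ws) tens (prodA s.1) (prodA s.2).
Proof.
elim: ws => [|w ws IHws] prim_ws.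
  by rewrite big_seq1 tensUU /Delta_a liftU deltaT_split splitT_one big_seq1.
have prim_w : primitive w by apply: prim_ws; rewrite mem_head.
rewrite [prodA _]/= Delta_mulA prim_w IHws; last first.
  by move=> v vws; apply: prim_ws; rewrite in_cons vws orbT.
rewrite (big_splits_cons _ (fun s1 s2 => tens (prodA s1) (prodA s2))) mulAADl.
apply: etrans (congr2 +%R (mulAA_sumr _ _ _) (mulAA_sumr _ _ _)) _.
congr (_ + _); apply: eq_bigr => s _; apply: etrans (mulAA_tens _ _ _ _) _.
  exact: (congr1 (tens (mulA w (prodA s.1))) (mul1A (prodA s.2))).
exact: (congr1 (fun u => tens u (mulA w (prodA s.2))) (mul1A (prodA s.1))).
Qed.

Lemma prodA_inA ws : (forall w, w \in ws -> inA P w) -> inA P (prodA ws).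
Proof.
elim: ws => [|w ws IHws] Aws; first by apply: supportedU; apply: mons1.
apply: supported_lift => a aw; apply: supported_lift => b bws.
apply: supportedU; apply: mons_veeM2; first by apply: (Aws w); rewrite ?mem_head.
by apply: IHws bws => v vws; apply: Aws; rewrite in_cons vws orbT.
Qed.

Lemma lift_pi_one : lift pi << one >> = 0.
Proof. by apply: etrans (liftU _ _) _; apply: pi_one. Qed.

Lemma compT_prodA n ws : (forall w, w \in ws -> primitive w) ->
  lift (compT n.+1) (prodA ws) = \sum_(s <- splits ws)
    consm (lift pi (prodA s.1)) (lift (compT n) (prodA s.2)).
Proof.
move=> prim_ws; pose G p := consm (pi p.1) (compT n p.2).
have -> : lift (compT n.+1) (prodA ws) = lift G (Delta_a (prodA ws)).
  by rewrite /Delta_a lift_lift; apply: eq_lift => t _; rewrite lift_deltaT.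
rewrite Delta_prodA // lift_big_sum; apply: eq_bigr => s _.
rewrite lift_tens consm_liftl; apply: eq_lift => a _.
by rewrite consm_lift.
Qed.

Lemma splits_inW (ws : seq A) s : (forall w, w \in ws -> inW P w) -> s \in splits ws ->
  (forall w, w \in s.1 -> inW P w) /\ (forall w, w \in s.2 -> inW P w).
Proof.
by move=> Wws /splits_sub[s1 s2]; split=> w; [move/s1 | move/s2]; apply: Wws.
Qed.

(** As pi kills 1, the first tensor factor consumes at least one element of [ws], leaving too few
    for the others. *)
Lemma compT_prodA_gt n ws : (forall w, w \in ws -> inW P w) ->
  (size ws < n)%N -> lift (compT n) (prodA ws) = 0.
Proof.
elim: n ws => [//|n IHn] ws Wws lt_n; rewrite compT_prodA; last first.
  by move=> w /Wws[].
rewrite big1_seq // => s /andP[_ s_ws]; have := splits_size s_ws.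
have [_ W2] := splits_inW Wws s_ws.
case: (s.1) => [|w s1] sz; first by rewrite lift_pi_one consm0l.
rewrite (IHn s.2) ?consm0 //; apply: leq_trans (_ : size ws <= n)%N => //.
by rewrite -sz addSn ltnS leq_addl.
Qed.

(** An empty [s.1] is killed by pi, and one of size at least 2 leaves too few elements for the
    remaining tensor factors. Only the splittings that isolate some w_i survive; pi fixes w_i, and
    the recursion is that of [symm_expand]. *)
Lemma compT_prodA_eq n ws : (forall w, w \in ws -> inW P w) ->
  size ws = n -> lift (compT n) (prodA ws) = lift (symm K n) (expand ws).
Proof.
elim: n ws => [|n IHn] ws Wws sz.
  case: ws sz Wws => [|//] _ _; rewrite /= liftU liftU.
  by rewrite /unitT eqxx /symm big_seq1.
rewrite compT_prodA; last by move=> w /Wws[].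
pose H s1 s2 := consm (lift pi (prodA s1)) (lift (compT n) (prodA s2)).
rewrite -[LHS]/(\sum_(s <- splits ws) H s.1 s.2).
have H0 s : s \in splits ws -> size s.1 != 1%N -> H s.1 s.2 = 0.
  move=> s_ws; have := splits_size s_ws; have [_ W2] := splits_inW Wws s_ws.
  case: (s.1) => [|w [|w' s1]] // sz12 _.
    by rewrite /H lift_pi_one consm0l.
  rewrite /H compT_prodA_gt ?consm0 //; move: sz12; rewrite sz /= !addSn.
  by case=> <-; rewrite ltnS leq_addl.
rewrite (bigID (fun s => size s.1 == 1%N)) /= [X in _ + X]big1_seq; last first.
  by move=> s /andP[s1 s_ws]; apply: H0.
rewrite addr0; apply: etrans (big_splits_size1 H 0 ws) _; rewrite sz.
apply: etrans (esym (symm_expand sz)); apply: eq_big_nat => i /andP[_ lt_i]; rewrite /H.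
have lt_iws : (i < size ws)%N by rewrite sz.
have perm_i := perm_del 0 lt_iws.
have Wi : inW P (nth 0 ws i) by apply/Wws/mem_nth.
have -> : lift pi (prodA [:: nth 0 ws i]) = nth 0 ws i.
  by rewrite /= mulA1; apply: (pi_primitive charK Wi).
rewrite IHn //; last by rewrite size_del // sz.
by move=> w w_del; apply: Wws; rewrite -(perm_mem perm_i) in_cons w_del orbT.
Qed.

Lemma inTW_preim n (c : TA) : inTW P n c -> exists f, [/\ inA P f,
  forall m, (n < m)%N -> lift (compT m) f = 0 &
  lift (compT n) f = lift (symm K n) c].
Proof.
elim=> [|d k ws sz Wws _ [f [Af f_gt f_n]]].
  exists 0; split=> [|m _|]; first exact: supported0.
    exact: (linear0 (lift _)).
  by rewrite [LHS]linear0 [RHS]linear0.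
exists (f + k *: prodA ws); split=> [|m lt_nm|].
- apply: supportedD => //; apply: supportedZ.
  by apply: prodA_inA => w /Wws[].
- by rewrite lift_add lift_scale f_gt // compT_prodA_gt ?sz // scaler0 addr0.
- by rewrite !lift_add !lift_scale f_n (compT_prodA_eq Wws sz).
Qed.

Lemma inC_lin (c d : TA) k : inC P c -> inC P d -> inC P (c + k *: d).
Proof.
move=> [sc Wc] [sd Wd]; split=> [|n]; first exact: symmetricD.
by rewrite tcompD tcompZ; apply: inTW_lin.
Qed.

Lemma fact_neq0 n : n`!%:R != 0 :> K.
Proof. by have /pcharf0P -> := charK; rewrite -lt0n fact_gt0. Qed.

(** Induction on a bound for the tensor degree: an element whose image has the same leading
    component is subtracted, and the difference stays in the target because images of phi lie
    there. *)
Lemma phi_surj c : inC P c -> exists2 f, inA P f & phi f = c.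
Proof.
have [N] : exists N, supported (fun u => (size u < N)%N) c.
  exists (\max_(u <- msupp c) size u).+1 => u uc.
  by rewrite ltnS; apply: leq_bigmax_seq.
elim: N c => [|N IHN] c sz_c Cc.
  exists 0; first exact: supported0.
  rewrite [LHS]linear0; apply/esym/malgP => u; rewrite mcoeff0.
  by apply: mcoeff_outdom; apply/negP => /sz_c.
have [sc Wc] := Cc; have [f [Af f_gt f_N]] := inTW_preim (Wc N).
(* The top component of [phi f] is the symmetrisation of [tcomp N c], which is N! times it since [c]
   is symmetric. *)
pose f1 := (N`!%:R)^-1 *: f.
have Af1 : inA P f1 by apply: supportedZ.
have f1_N : tcomp N (phi f1) = tcomp N c.
  rewrite (tcomp_phi N Af1) lift_scale f_N symm_symmetric.
  - by rewrite scalerA mulVf ?scale1r ?fact_neq0.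
  - exact: symmetric_tcomp.
  - exact: inTW_size (Wc N).
have f1_gt m : (N < m)%N -> tcomp m (phi f1) = 0.
  by move=> lt_Nm; rewrite (tcomp_phi m Af1) lift_scale f_gt // scaler0.
have [||f2 Af2 phi_f2] := IHN (c + (-1) *: phi f1).
(* In length [N] the coefficients cancel by [f1_N]; in larger lengths both terms vanish. *)
- move=> u; rewrite -mcoeff_neq0 ltnNge; apply: contraNN => le_Nu.
  have coefE (d : TA) : d@_u = (tcomp (size u) d)@_u by rewrite mcoeff_tcomp eqxx.
  rewrite mcoeffD mcoeffZ mulN1r subr_eq0; apply/eqP; rewrite [RHS]coefE.
  move: le_Nu; rewrite leq_eqVlt => /predU1P[uN|lt_Nu].
    by rewrite -uN f1_N mcoeff_tcomp uN eqxx.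
  rewrite f1_gt // mcoeff0; apply: mcoeff_outdom; apply/negP => /sz_c.
  by rewrite ltnS leqNgt lt_Nu.
- by apply: inC_lin Cc _; apply: phi_inC.
exists (f1 + f2); first exact: supportedD.
by rewrite [LHS]lift_add [lift _ f2]phi_f2 scaleN1r addrC subrK.
Qed.

End Surjectivity.

Theorem theorem4p7p6 (K : fieldType) (hK : [pchar K] =i pred0)
    (X : countType) (binary : bool) :
  let P : pred (mtree X) := if binary then @isbin X else @ismon X in
  exists phi : {linear {malg K[mtree X]} -> {malg K[seq (mtree X)]}},
    (* phi is a bijection from A onto C *)
    [/\ (forall f, inA P f -> inC P (phi f)),
        (forall f g, inA P f -> inA P g -> phi f = phi g -> f = g) &
        (forall c, inC P c -> exists2 f, inA P f & phi f = c)] /\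
    (* phi preserves the grading, the counit and the coproduct *)
    [/\ (forall (d : nat) f, inA P f -> homogA d f -> homogT d (phi f)),
        (forall f, inA P f -> counitT (phi f) = counitA f) &
        (forall f, inA P f -> deltaDec (phi f) = tensmap phi phi (Delta_a f))].
Proof.
exists (@phi K X); split; split.
- exact: (@phi_inC K X binary).
- move=> f g Af Ag eq_fg; apply/eqP; rewrite -subr_eq0; apply/eqP.
  apply: (@phi_inj0 K X binary hK).
    by rewrite -scaleN1r; apply: supportedD => //; apply: supportedZ.
  by rewrite linearB; apply/eqP; rewrite subr_eq0; apply/eqP.
- exact: (@phi_surj K X binary hK).
- exact: (@phi_homog K X binary).
- exact: (@phi_counit K X binary).
- exact: (@phi_delta K X binary).
Qed.
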